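(* Let $d\ge 2$, $\lambda>0$, let $\mu_1$ be the Cauchy distribution $d\mu_1(x)=\frac{\lambda}{\pi(x^2+\lambda^2)}dx$, let $\mu_2$ be any probability measure on $\mathbb{R}$, and let $H^\omega$ be the Anderson model on $\ell^2(\mathbb{Z}^d)$ with single site distribution $\mu=\mu_1*\mu_2$ and density of states function $\rho$. Let $0<\gamma<\frac{d-1}{2d}$, $\beta=d-\gamma$, and let $E\in\mathbb{R}$ satisfy $\rho(E)>0$. For $L\in\mathbb{N}$ define the random measure $$\mu^\omega_{E,L}(\cdot)=\frac{1}{(2L+1)^\beta}\sum_{E_j\in\sigma(H^\omega_L)}\delta_{(2L+1)^\gamma(E_j-E)}(\cdot).$$ Then for a.e. $\omega$, $$\mu^\omega_{E,L}(\cdot)\longrightarrow\rho(E)\,\mathcal{L}(\cdot)\quad\text{vaguely as }L\to\infty,$$ where $\mathcal{L}$ denotes Lebesgue measure on $\mathbb{R}$.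
   Context: Anderson model with single site distribution (SSD) $\mu$: the random self-adjoint operator $H^\omega=\Delta+V^\omega$ on $\ell^2(\mathbb{Z}^d)$, where $(\Delta u)(n)=\sum_{|k-n|=1}u(k)$ and $(V^\omega u)(n)=\omega_n u(n)$, with $\{\omega_n\}_{n\in\mathbb{Z}^d}$ i.i.d. real random variables of law $\mu$. Let $\Lambda_L=\{n\in\mathbb{Z}^d:|n_i|\le L,\ 1\le i\le d\}$, $\chi_L$ the orthogonal projection onto $\ell^2(\Lambda_L)$, and $H^\omega_L=\chi_LH^\omega\chi_L$, a symmetric matrix of order $(2L+1)^d$; sums over $\sigma(H^\omega_L)$ count eigenvalues with multiplicity. $\delta_b$ is the Dirac measure at $b$. Density of states: $\mathcal{N}(E)=\lim_{L\to\infty}(2L+1)^{-d}\#\{j:E_j\le E,\ E_j\in\sigma(H^\omega_L)\}$ (nonrandom limit, a.e. $\omega$) is the integrated density of states, and the density of states measure $\nu$ is defined by $\nu(-\infty,E]=\mathcal{N}(E)$ (equivalently $\nu(B)=\mathbb{E}\langle e_0,E_{H^\omega}(B)e_0\rangle$, with $E_{H^\omega}$ the spectral measure and $\{e_n\}$ the standard basis). For SSD $\mu_1*\mu_2$ the measure $\nu$ is absolutely continuous; its density $\rho$, the density of states function, has a continuous (indeed $C^\infty$) version, and $\rho(E)$ refers to that version. Vague convergence $\mu_n\to\mu$ of measures on $\mathbb{R}$ means $\int f\,d\mu_n\to\int f\,d\mu$ for every continuous compactly supported $f:\mathbb{R}\to\mathbb{R}$. *)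

(* Defs.v *)
From HB Require Import structures.
From mathcomp Require Import all_boot all_order all_algebra.
From mathcomp Require Import finmap ring zify.
From mathcomp Require Import polyrcf.
From mathcomp Require Import all_classical all_reals all_analysis.
From mathcomp Require Import measurable_realfun.

Set Implicit Arguments.
Unset Strict Implicit.
Unset Printing Implicit Defensive.

Import Order.TTheory GRing.Theory Num.Theory.
Import numFieldNormedType.Exports.

Local Open Scope classical_set_scope.
Local Open Scope ring_scope.

Definition cauchy_pdf {R : realType} (lambda x : R) : R :=
  lambda / (pi * (x ^+ 2 + lambda ^+ 2)).

Definition cauchy_prob {R : realType} (lambda : R) :
    set (measurableTypeR R) -> \bar R :=
  fun A => (\int[lebesgue_measure]_(x in A) (cauchy_pdf lambda x)%:E)%E.

Section cauchy.
Context {R : realType} (lambda : R).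
Hypothesis lambda_gt0 : 0 < lambda.

Let denom_gt0 (x : R) : 0 < pi * (x ^+ 2 + lambda ^+ 2).
Proof.
by rewrite mulr_gt0 ?pi_gt0// ltr_wpDl ?sqr_ge0// exprn_gt0.
Qed.

Lemma cauchy_pdf_ge0 x : 0 <= cauchy_pdf lambda x.
Proof. by rewrite divr_ge0 ?ltW. Qed.

Lemma continuous_cauchy_pdf : continuous (cauchy_pdf lambda).
Proof.
move=> x; rewrite /continuous_at /cauchy_pdf.
apply: cvgM; first exact: cvg_cst.
apply: cvgV; first by rewrite gt_eqF.
apply: cvgM; first exact: cvg_cst.
by apply: cvgD; [exact: exprn_continuous|exact: cvg_cst].
Qed.

Lemma measurable_cauchy_pdf : measurable_fun [set: R] (cauchy_pdf lambda).
Proof. exact: continuous_measurable_fun continuous_cauchy_pdf. Qed.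

Let F (x : R) : R := pi^-1 * atan (lambda^-1 * x).

Let is_derive_F (x : R) : is_derive x 1 F (cauchy_pdf lambda x).
Proof.
have h : is_derive x 1 (fun x : R => lambda^-1 * x) lambda^-1.
  by apply: is_derive_eq; rewrite /GRing.scale /= mulr1.
have := @is_derive1_comp _ (@atan R) _ _ _ _ (is_derive1_atan (lambda^-1 * x)) h.
move=> /(is_deriveZ pi^-1) hZ; apply: (is_derive_eq hZ).
rewrite /cauchy_pdf /GRing.scale /=.
have l0 : lambda != 0 by rewrite gt_eqF.
have : pi != 0 :> R by rewrite gt_eqF ?pi_gt0.
have : x ^+ 2 + lambda ^+ 2 != 0.
  by have := denom_gt0 x; rewrite pmulr_rgt0 ?pi_gt0// => /gt_eqF ->.
move: (pi : R) => p s0 p0.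
by field; rewrite s0 p0 l0.
Qed.

Lemma integral_cauchy_pdf :
  (\int[lebesgue_measure]_x (cauchy_pdf lambda x)%:E = 1)%E.
Proof.
rewrite ge0_symfun_integralT; last 3 first.
- exact: cauchy_pdf_ge0.
- exact: continuous_cauchy_pdf.
- by move=> x; rewrite /cauchy_pdf /= sqrrN.
rewrite (_ : [set x | _] = `[0, +oo[%classic); last first.
  by apply/seteqP; split => x/=; rewrite in_itv/= andbT.
rewrite (@ge0_continuous_FTC2y _ _ F 0 2^-1).
- by rewrite /F mulr0 atan0 mulr0 sube0 -EFinM divff.
- by move=> x _; exact: cauchy_pdf_ge0.
- by apply: continuous_subspaceT; exact: continuous_cauchy_pdf.
- rewrite [2^-1](_ : _ = pi^-1 * (pi / 2)); last first.
    by rewrite mulKf// gt_eqF ?pi_gt0.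
  apply: cvgM; first exact: cvg_cst.
  apply: (@cvg_comp _ _ _ _ _ _ (pinfty_nbhs R)); last exact: cvgy_atan.
  by apply: gt0_cvgMry; [rewrite invr_gt0|exact: cvg_id].
- by move=> x _; apply: ex_derive.
- apply: cvg_at_right_filter; apply: differentiable_continuous.
  by apply/derivable1_diffP; apply: ex_derive.
- by move=> x _; rewrite derive1E; exact: derive_val.
Qed.

Local Notation cauchy := (cauchy_prob lambda).

Let cauchy0 : cauchy set0 = 0%E.
Proof. by rewrite /cauchy_prob integral_set0. Qed.

Let cauchy_ge0 A : (0 <= cauchy A)%E.
Proof. by apply: integral_ge0 => x _; rewrite lee_fin cauchy_pdf_ge0. Qed.

Let cauchy_sigma_additive : semi_sigma_additive cauchy.
Proof.
move=> /= G mG tG mUG; rewrite /cauchy_prob; apply: cvg_toP.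
  apply: ereal_nondecreasing_is_cvgn => m n mn.
  by apply: lee_sum_nneg_natr => // k _ _; exact: cauchy_ge0.
rewrite ge0_integral_bigcup//=.
- apply/measurable_funTS/measurableT_comp => //.
  exact: measurable_cauchy_pdf.
- by move=> x _; rewrite lee_fin cauchy_pdf_ge0.
Qed.

HB.instance Definition _ := isMeasure.Build _ _ _
  cauchy cauchy0 cauchy_ge0 cauchy_sigma_additive.

Let cauchy_setT : cauchy [set: R] = 1%E.
Proof. exact: integral_cauchy_pdf. Qed.

HB.instance Definition _ :=
  @Measure_isProbability.Build _ _ R cauchy cauchy_setT.

Definition cauchy_probability : probability (measurableTypeR R) R := cauchy.

End cauchy.

Definition convolution {R : realType}
    (mu1 mu2 : set (measurableTypeR R) -> \bar R) :
    set (measurableTypeR R) -> \bar R :=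
  pushforward (mu1 \x mu2)%E
    (fun z : measurableTypeR R * measurableTypeR R =>
       z.1 + z.2 : measurableTypeR R).

Section vague_convergence.
Context {R : realType}.

Definition compactly_supported (f : R -> R) :=
  compact (closure [set x | f x != 0]).

Definition vague_cvg (m : {measure set (measurableTypeR R) -> \bar R}^nat)
    (l : {measure set (measurableTypeR R) -> \bar R}) :=
  forall f : R -> R, continuous f -> compactly_supported f ->
    (\int[m n]_x (f x)%:E @[n --> \oo] --> \int[l]_x (f x)%:E)%E.

End vague_convergence.

Section iid.
Context {disp : measure_display} {Omega : measurableType disp} {R : realType}
  {P : probability Omega R} {I : choiceType}.

Definition mutually_independent (X : I -> {RV P >-> R}) :=
  forall (J : {fset I}) (A : I -> set (measurableTypeR R)), (forall i, measurable (A i)) ->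
    (P (\bigcap_(i in [set` J]) X i @^-1` A i) =
     \prod_(i <- J) P (X i @^-1` A i))%E.

Definition iid_with_law (X : I -> {RV P >-> R}) (mu : set (measurableTypeR R) -> \bar R) :=
  mutually_independent X /\
  (forall i (A : set (measurableTypeR R)), measurable A -> distribution P (X i) A = mu A).

End iid.

Section eigenvalues.
Context {R : realType} {n : nat}.

(* The real eigenvalues, each listed with its multiplicity as a root of the
   characteristic polynomial; for a symmetric matrix these are all the
   eigenvalues, and the length of the list is n. *)
Definition eigenvalues (A : 'M[R]_n) : seq R :=
  flatten [seq nseq (mup x (char_poly A)) x | x <- rootsR (char_poly A)].

Lemma mem_eigenvalues (A : 'M[R]_n) x : (x \in eigenvalues A) = eigenvalue A x.
Proof.
have p0 : char_poly A != 0 by rewrite monic_neq0 ?char_poly_monic.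
rewrite eigenvalue_root_char; apply/flatten_mapP/idP => [[y yr]|rx].
  rewrite mem_nseq => /andP[_ /eqP ->].
  by move: (roots_on_rootsR p0 y); rewrite yr => /andP[].
exists x; first by rewrite -roots_on_rootsR.
by rewrite mem_nseq eqxx andbT -XsubC_dvd// dvdp_XsubCl.
Qed.

End eigenvalues.

Section anderson.
Context {R : realType} {d : nat}.

Local Notation Zd := 'rV[int]_d.

Definition l1norm (n : Zd) : int := \sum_i `|n 0 i|.

(* On integer vectors the l1 norm and the Euclidean norm take the value 1 at the
   same points, so this sum is over the 2d nearest neighbours of n. *)
Definition laplacian (u : Zd -> R) : Zd -> R :=
  fun n => \sum_(k \in [set k | l1norm (k - n) = 1]) u k.

(* The difference expression of the operator, on arbitrary functions on Z^d;
   only its action on finitely supported functions is used. *)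
Definition anderson (v : Zd -> R) (u : Zd -> R) : Zd -> R :=
  fun n => laplacian u n + v n * u n.

Definition basis (m : Zd) : Zd -> R := fun n => (n == m)%:R.

Definition box (L : nat) : set Zd := [set n | forall i, `|n 0 i| <= L%:Z].

Definition box_card (L : nat) : nat := #|{ffun 'I_d -> 'I_(2 * L).+1}|.

Definition site (L : nat) (i : 'I_(box_card L)) : Zd :=
  \row_j ((enum_val i j)%:Z - L%:Z).

Lemma box_cardE L : box_card L = ((2 * L + 1) ^ d)%N.
Proof. by rewrite /box_card card_ffun !card_ord addn1. Qed.

Lemma site_inj L : injective (@site L).
Proof.
move=> i i' /rowP e; apply/enum_val_inj/ffunP => j; apply/val_inj.
by move: (e j); rewrite !mxE => /addIr [].
Qed.

Lemma site_bij L : set_bij [set: 'I_(box_card L)] (box L) (@site L).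
Proof.
split; first 2 last.
- move=> n /= nL; exists (enum_rank [ffun j => inord (absz (n 0 j + L%:Z))]) => //.
  apply/rowP => j; rewrite mxE enum_rankK ffunE inordK; last first.
    by have := nL j; lia.
  by have := nL j; lia.
- move=> i _ j /=; rewrite mxE; have := ltn_ord (enum_val i j); lia.
- by move=> i i' _ _; exact: site_inj.
Qed.

(* The matrix, in the standard basis, of the compression of the Anderson
   operator to the box of radius L. *)
Definition anderson_box (v : Zd -> R) (L : nat) : 'M[R]_(box_card L) :=
  \matrix_(i, j) anderson v (basis (site j)) (site i).

Lemma laplacian_basis m n : laplacian (basis m) n = (l1norm (m - n) == 1)%:R.
Proof.
rewrite /laplacian; case: eqP => mn.
  rewrite -(@fsbig_widen _ _ _ _ [set m]) ?fsbig_set1 ?/basis ?eqxx//.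
    by move=> k ->.
  by move=> k [_ /eqP km]; rewrite /= (negbTE km).
by rewrite fsbig1// => k /= kn; rewrite /basis; case: eqP => // km;
  rewrite km in kn.
Qed.

Lemma anderson_boxE v L i j : anderson_box v L i j =
  (l1norm (site j - site i) == 1)%:R + (i == j)%:R * v (site i).
Proof.
by rewrite mxE /anderson laplacian_basis /basis (inj_eq (@site_inj L)) mulrC.
Qed.

Lemma anderson_box_sym v L : (anderson_box v L)^T = anderson_box v L.
Proof.
apply/matrixP => i j; rewrite mxE !anderson_boxE; congr (_ + _).
  rewrite /l1norm; congr ((_ == _)%:R).
  by apply: eq_bigr => k _; rewrite !mxE distrC.
by rewrite eq_sym; case: eqP => [->//|]; rewrite !mul0r.
Qed.

End anderson.

Section density_of_states.
Context {R : realType} {d : nat} {disp : measure_display}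
  {Omega : measurableType disp} {P : probability Omega R}.
Variable V : 'rV[int]_d -> {RV P >-> R}.

Definition spectrum_box (L : nat) (w : Omega) : seq R :=
  eigenvalues (anderson_box (fun n => V n w) L).

(* N does not depend on w, and the exceptional set may depend on E. *)
Definition integrated_dos (N : R -> R) :=
  forall E : R, {ae P, forall w : Omega,
    (((2 * L + 1) ^ d)%:R^-1 *
       (count (fun x => x <= E) (spectrum_box L w))%:R) @[L --> \oo]
    --> N E}.

Definition dos_measure (nu : {measure set (measurableTypeR R) -> \bar R}) :=
  exists2 N : R -> R, integrated_dos N &
    forall E : R, nu `]-oo, E]%classic = (N E)%:E.

(* The continuity of rho selects one representative of the density of nu. *)
Definition dos_function (rho : R -> R) :=
  continuous rho /\
  exists2 nu : {measure set (measurableTypeR R) -> \bar R}, dos_measure nu &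
    forall A : set (measurableTypeR R), measurable A ->
      (nu A = \int[lebesgue_measure]_(x in A) (rho x)%:E)%E.

Definition eigenvalue_process (gamma beta E : R) (L : nat) (w : Omega) :
    {measure set (measurableTypeR R) -> \bar R} :=
  mscale (NngNum (powR_ge0 (2 * L + 1)%:R (- beta)))
    (msum (fun j : nat =>
       \d_((2 * L + 1)%:R `^ gamma * ((spectrum_box L w)`_j - E)
            : measurableTypeR R))
      (size (spectrum_box L w))).

End density_of_states.

(* Main.v *)
(** Replacing the potential at one site is a rank-one perturbation, so it moves the
    number of eigenvalues below a level by at most one; as a function of the
    [(2L+1)^d] independent potentials this number therefore has variance at most
    [(2L+1)^d] (Efron-Stein).  Cutting a large box into boxes of radius [L] is a
    perturbation of rank [O((2L+1)^(d-1))] per tile, so the mean count below [x]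
    is [(2L+1)^d N(x) + O((2L+1)^(d-1))] uniformly in [x], [N] being the integrated
    density of states.  Both errors are negligible against the [(2L+1)^(d-gamma)]
    eigenvalues in a window of size [(2L+1)^(-gamma)]: the first almost surely by
    summability of the variances (as [d - 2 gamma > 1]), the second because
    [gamma < 1].  Continuity of [rho] then gives the limiting mass of every window
    with rational ends. *)

Require Import Defs.
From HB Require Import structures.
From mathcomp Require Import all_boot all_order all_algebra.
From mathcomp Require Import finmap ring lra zify.
From mathcomp Require Import polyrcf complex spectral.
From mathcomp Require Import all_classical all_reals all_analysis.
From mathcomp Require Import measurable_realfun.

Set Implicit Arguments.
Unset Strict Implicit.
Unset Printing Implicit Defensive.

Import Order.TTheory GRing.Theory Num.Theory.
Import numFieldNormedType.Exports.

Local Open Scope classical_set_scope.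
Local Open Scope ring_scope.

(** * Counting eigenvalues of symmetric matrices *)

Section EigenvalueCount.
Local Open Scope complex_scope.
Local Open Scope sesquilinear_scope.

(** The levels at which eigenvalues are counted, [E + (2L+1)^(-gamma) a], move with [L], whereas
    [integrated_dos] gives a limit at each fixed level only, without a rate and with a null set
    depending on the level. Hence [N] is reached through means: at a fixed level the tile is kept
    fixed while the number of tiles tends to infinity, and a limit without rate becomes a bound
    explicit in the tile, the same for every level. Only the fluctuation around the mean is then
    treated along moving levels. Its normalised square has mean at most [(2L+1)^(2 gamma - d)],
    summable over all [L], so no subsequence or interpolation is needed. The price is one null set
    per sequence of levels, which is why the window ends are restricted to rationals. *)

Definition eig_count {R : realType} {n : nat} (A : 'M[R]_n) (x : R) : nat :=
  count (fun y => y <= x) (eigenvalues A).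

Definition complexmx {R : realType} {m n : nat} (A : 'M[R]_(m, n)) : 'M[R[i]]_(m, n) :=
  map_mx (real_complex R) A.

Definition real_diag {R : realType} {n : nat} (d : 'I_n -> R) : 'M[R[i]]_n :=
  diag_mx (\row_i (d i)%:C).

(** [Q] is complex because it comes from the spectral theorem for Hermitian matrices; [d] is real so
    that its values can be compared with a level. Vectors are rows, and [v *m Q^t*] lists the
    coordinates of [v] in the eigenbasis. *)
Definition spectral_dec {R : realType} {n : nat} (A : 'M[R]_n)
    (Q : 'M[R[i]]_n) (d : 'I_n -> R) : Prop :=
  Q \is unitarymx /\ complexmx A = Q^t* *m real_diag d *m Q.

Lemma char_poly_conj {F : fieldType} n (P A : 'M[F]_n) :
  P \in unitmx -> char_poly (invmx P *m A *m P) = char_poly A.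
Proof.
move=> Pu; rewrite /char_poly /char_poly_mx.
have PuX : map_mx polyC P \in unitmx by rewrite map_unitmx.
have -> : 'X%:M - map_mx polyC (invmx P *m A *m P) =
    invmx (map_mx polyC P) *m ('X%:M - map_mx polyC A) *m map_mx polyC P.
  rewrite mulmxBr mulmxBl scalar_mxC -[_%:M *m _ *m _]mulmxA mulVmx // mulmx1.
  by rewrite !map_mxM map_invmx.
rewrite !det_mulmx mulrAC -det_mulmx mulVmx // det1 mul1r //.
Qed.

Section SpectralDecomposition.
Context {R : realType}.

Lemma symmetric_spectral n (A : 'M[R]_n) :
  A^T = A -> exists Q d, spectral_dec A Q d.
Proof.
move=> symA.
have Ah : complexmx A \is hermsymmx.
  apply: realsym_hermsym.
    by apply/is_hermitianmxP; rewrite scale1r map_mx_id // map_trmx symA.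
  by apply/mxOverP => i j; rewrite mxE; apply/complex_realP; exists (A i j).
exists (spectralmx (complexmx A)), (fun i => complex.Re (spectral_diag (complexmx A) 0 i)).
split; first exact: spectral_unitarymx.
have /hermitian_normalmx/orthomx_spectralP {1}-> := Ah.
rewrite -invmx_unitary ?spectral_unitarymx //; congr (_ *m _ *m _).
rewrite /real_diag; congr diag_mx; apply/rowP => i; rewrite mxE RRe_real //.
by have /mxOverP := hermitian_spectral_diag_real Ah.
Qed.

(** Conjugation invariance factors the characteristic polynomial into the ['X - d i], and
    [eigenvalues] lists each root with its multiplicity there. *)
Lemma eigenvalues_spectral n (A : 'M[R]_n) Q d :
  spectral_dec A Q d -> perm_eq (eigenvalues A) [seq d i | i <- enum 'I_n].
Proof.
move=> [Qu QA].
have cA : char_poly A = \prod_(y <- [seq d i | i <- enum 'I_n]) ('X - y%:P).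
  apply: (@map_poly_inj _ _ (real_complex R)).
  rewrite map_char_poly -/(complexmx A) QA -invmx_unitary //.
  rewrite char_poly_conj ?unitarymx_unit // char_poly_trig ?diag_mx_is_trig //.
  rewrite rmorph_prod /= big_map big_enum /=; apply: eq_bigr => i _.
  by rewrite rmorphB /= map_polyX map_polyC /= !mxE eqxx.
have p0 : char_poly A != 0 by rewrite monic_neq0 ?char_poly_monic.
have cm y : count_mem y (eigenvalues A) = mup y (char_poly A).
  rewrite /eigenvalues count_flatten -map_comp sumnE big_map.
  rewrite (eq_bigr (fun x => if x == y then mup y (char_poly A) else 0%N)); last first.
    by move=> x _ /=; rewrite count_nseq /=; case: eqP => [->|]; rewrite ?mul1n.
  rewrite -big_mkcond /= big_const_seq.
  have [yr|yr] := boolP (y \in rootsR (char_poly A)).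
    by rewrite count_uniq_mem ?uniq_roots // yr /= addn0.
  rewrite (count_memPn yr) /= mupNroot //; apply: contra yr => yr.
  by rewrite -roots_on_rootsR // yr.
by apply/permP => a; apply/permP: a; apply/allP => y _ /=; rewrite cm cA mu_prod_XsubC.
Qed.

Lemma eig_count_spectral n (A : 'M[R]_n) Q d x :
  spectral_dec A Q d -> eig_count A x = #|[pred i | d i <= x]|.
Proof.
move=> /eigenvalues_spectral/permP pA; rewrite /eig_count pA count_map.
by rewrite -sum1_card -sum1_count big_enum_cond.
Qed.

Lemma size_eigenvalues n (A : 'M[R]_n) : A^T = A -> size (eigenvalues A) = n.
Proof.
move=> /symmetric_spectral[Q [d QA]].
by rewrite (perm_size (eigenvalues_spectral QA)) size_map -cardE card_ord.
Qed.

(** Each row in [p] contributes a matrix of rank at most one. Every rank estimate below has this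
    source: spectral cut-offs, one changed site, tile boundaries. *)
Lemma mxrank_sparse {F : fieldType} m n (A : 'M[F]_(m, n)) (p : pred 'I_m) :
  (forall i j, ~~ p i -> A i j = 0) -> (\rank A <= #|p|)%N.
Proof.
move=> A0.
have -> : A = \sum_(i | p i) delta_mx i 0 *m row i A.
  apply/matrixP => i j; rewrite summxE.
  under eq_bigr do rewrite mxE big_ord1 !mxE eqxx andbT.
  have [pi|npi] := boolP (p i).
    rewrite (bigD1 i) //= eqxx mul1r big1 ?addr0 // => k /andP[_ ki].
    by rewrite eq_sym (negbTE ki) mul0r.
  rewrite A0 // big1 // => k pk; case: eqP => [ik|]; last by rewrite mul0r.
  by rewrite ik pk in npi.
rewrite -sum1_card; elim/big_rec2: _ => [|i k M _ leM]; first by rewrite mxrank0.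
rewrite (leq_trans (mxrank_add _ _)) // leq_add //.
by rewrite (leq_trans (mxrankM_maxr _ _)) // rank_leq_row.
Qed.

Lemma quadratic_spectral n (A : 'M[R]_n) Q d (v : 'rV[R[i]]_n) :
  spectral_dec A Q d ->
  (v *m complexmx A *m v^t*) 0 0 = \sum_i (d i)%:C * `|(v *m Q^t*) 0 i| ^+ 2.
Proof.
move=> [_ ->]; have wE : (v *m Q^t*)^t* = Q *m v^t*.
  by rewrite trmx_mul map_mxM trmxCK.
rewrite !mulmxA -mulmxA -wE mul_mx_diag mxE; apply: eq_bigr => i _.
by rewrite !mxE mulrAC mulrC normCK.
Qed.

Lemma norm_spectral n (A : 'M[R]_n) Q d (v : 'rV[R[i]]_n) :
  spectral_dec A Q d -> (v *m v^t*) 0 0 = \sum_i `|(v *m Q^t*) 0 i| ^+ 2.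
Proof.
move=> [Qu _]; have -> : v *m v^t* = (v *m Q^t*) *m (v *m Q^t*)^t*.
  by rewrite trmx_mul map_mxM trmxCK mulmxA mulmxKtV.
by rewrite mxE; apply: eq_bigr => i _; rewrite !mxE normCK.
Qed.

Lemma mxrank_row_mx {F : fieldType} m n1 n2 (A : 'M[F]_(m, n1)) (B : 'M[F]_(m, n2)) :
  (\rank (row_mx A B) <= \rank A + \rank B)%N.
Proof.
rewrite -mxrank_tr tr_row_mx -[\rank A]mxrank_tr -[\rank B]mxrank_tr.
by rewrite -addsmxE (mxrank_adds_leqif _ _).1.
Qed.

(* A dimension count gives a common vector of the spectral subspaces
   [d > x] excluded, [e <= x] excluded, and of the kernel of [Z]; on it the two
   quadratic forms would be separated by [x]. *)
Lemma eig_count_le_rank n (A B : 'M[R]_n) m (Z : 'M[R[i]]_(n, m)) x :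
  A^T = A -> B^T = B ->
  (forall v : 'rV_n, v *m Z = 0 ->
    (v *m complexmx B *m v^t*) 0 0 <= (v *m complexmx A *m v^t*) 0 0) ->
  (eig_count A x <= eig_count B x + \rank Z)%N.
Proof.
move=> /symmetric_spectral[Q [d QA]] /symmetric_spectral[S [e SB]] AB.
rewrite (eig_count_spectral _ QA) (eig_count_spectral _ SB) leqNgt; apply/negP => lt.
(* [v *m X^t* = 0] removes the components of [v] on eigenvectors of [A] with [d i > x]; [Y] does the
   same for those of [B] with [e i <= x]. *)
pose X := real_diag (fun i => (~~ (d i <= x))%:R) *m Q.
pose Y := real_diag (fun i => (e i <= x)%R%:R) *m S.
pose M := row_mx (X^t*) (row_mx (Y^t*) Z).
have rX : (\rank (X^t*) <= #|[pred i | ~~ (d i <= x)%R]|)%N.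
  rewrite mxrank_map mxrank_tr; apply: mxrank_sparse => i j /= /negbTE di.
  by rewrite /X mul_diag_mx !mxE di mul0r.
have rY : (\rank (Y^t*) <= #|[pred i | (e i <= x)%R]|)%N.
  rewrite mxrank_map mxrank_tr; apply: mxrank_sparse => i j /= /negbTE di.
  by rewrite /Y mul_diag_mx !mxE di mul0r.
(* The negated claim says exactly that [n - eig_count A x], [eig_count B x] and [\rank Z] add up to
   less than [n]. *)
have rM : (\rank M < n)%N.
  have cE := cardC [pred i | (d i <= x)%R]; rewrite card_ord in cE.
  apply: leq_trans (eq_leq cE); apply: leq_trans (leq_add lt (leqnn _)).
  rewrite addSn ltnS [leqRHS]addnC.
  rewrite (leq_trans (mxrank_row_mx _ _)) // leq_add //.
  by rewrite (leq_trans (mxrank_row_mx _ _)) // leq_add2r.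
have /rowV0Pn[v /sub_kermxP vM v0] : kermx M != 0.
  by rewrite -mxrank_eq0 mxrank_ker -lt0n subn_gt0.
move: vM; rewrite /M !mul_mx_row -[0]row_mx0 => /eq_row_mx[vX].
rewrite -[0]row_mx0 => /eq_row_mx[vY vZ].
have tX (T : 'M[R[i]]_n) (f : 'I_n -> bool) :
  v *m (real_diag (fun i => (f i)%:R) *m T)^t* = 0 ->
  forall i, f i -> (v *m T^t*) 0 i = 0.
  rewrite trmx_mul map_mxM tr_diag_mx map_diag_mx mulmxA mul_mx_diag.
  move=> /rowP/[swap] i /(_ i) + fi; rewrite !mxE fi -[(true%:R)%:C]/(1 : R[i]).
  by rewrite rmorph1 mulr1.
have {}vX := tX _ _ vX; have {}vY := tX _ _ vY.
have := AB v vZ; rewrite (quadratic_spectral v QA) (quadratic_spectral v SB).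
rewrite lt_geF //.
apply: (@le_lt_trans _ _ (x%:C * (v *m v^t*) 0 0)).
  rewrite (norm_spectral v QA) mulr_sumr; apply: ler_sum => i _.
  have [dx|/vX ->] := boolP (d i <= x); last by rewrite normr0 expr0n /= !mulr0.
  by rewrite ler_wpM2r ?exprn_ge0 // lecR.
rewrite (norm_spectral v SB) mulr_sumr -subr_gt0 -sumrB.
have t0 i : 0 <= (e i)%:C * `|(v *m S^t*) 0 i| ^+ 2 - x%:C * `|(v *m S^t*) 0 i| ^+ 2.
  have [/vY ->|ex] := boolP (e i <= x); first by rewrite normr0 expr0n /= !mulr0 subrr.
  by rewrite -mulrBl mulr_ge0 ?exprn_ge0 // subr_ge0 lecR ltW // ltNge.
(* Strictness: the components of [v] with [e i <= x] vanish, so a nonzero one has [e i > x]. *)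
rewrite lt_def sumr_ge0 // andbT psumr_neq0 //.
have /rV0Pn[i wi] : v *m S^t* != 0.
  by apply: contraNneq v0 => w0; rewrite -(mulmxKtV v SB.1) // w0 mul0mx.
apply/hasP; exists i; rewrite ?mem_index_enum //= -mulrBl mulr_gt0 ?exprn_gt0 ?normr_gt0 //.
by rewrite subr_gt0 ltcR ltNge; apply: contra wi => /vY ->.
Qed.

Lemma eig_count_rank n (A B : 'M[R]_n) x : A^T = A -> B^T = B ->
  (eig_count A x <= eig_count B x + \rank (A - B)%R)%N.
Proof.
move=> sA sB; rewrite -(mxrank_map (real_complex R)) map_mxB.
apply: eig_count_le_rank => // v /eqP.
by rewrite mulmxBr subr_eq0 => /eqP ->.
Qed.

(** The comparison of forms holds on the whole space, so the rank lemma applies with [Z = 0]. *)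
Lemma eig_count_diag_le n (A : 'M[R]_n) (e : 'I_n -> R) x :
  A^T = A -> (forall i, 0 <= e i) ->
  (eig_count (A + diag_mx (\row_i e i)) x <= eig_count A x)%N.
Proof.
move=> sA e0.
suff: (eig_count (A + diag_mx (\row_i e i)) x <=
  eig_count A x + \rank (0%R : 'M[R[i]]_n))%N.
  by rewrite mxrank0 addn0.
apply: eig_count_le_rank => // [|v _]; first by rewrite linearD /= tr_diag_mx sA.
rewrite [complexmx (_ + _)]map_mxD mulmxDr mulmxDl [leRHS]mxE lerDl.
rewrite map_diag_mx mul_mx_diag mxE; apply: sumr_ge0 => i _.
by rewrite !mxE mulrAC mulr_ge0 -?normCK ?exprn_ge0 // ler0c.
Qed.

(** It trades a uniform change of the potential for a change of level, which left continuity of the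
    counts rests on. *)
Lemma eig_count_shift n (A : 'M[R]_n) (t x : R) : A^T = A ->
  eig_count (A + t%:M) (x + t) = eig_count A x.
Proof.
move=> /symmetric_spectral[Q [d QA]].
have QA' : spectral_dec (A + t%:M) Q (fun i => d i + t).
  split; first exact: QA.1.
  rewrite [complexmx _]map_mxD -/(complexmx A) QA.2 map_scalar_mx.
  have -> : real_diag (fun i => d i + t) = real_diag d + (t%:C)%:M.
    apply/matrixP => i j; rewrite !mxE rmorphD /= mulrnDl.
    by case: eqP => // ->.
  rewrite mulmxDr mulmxDl; congr (_ + _).
  by rewrite scalar_mxC mulmxKtV ?QA.1.
rewrite (eig_count_spectral _ QA) (eig_count_spectral _ QA').
by apply: eq_card => i; rewrite !inE lerD2r.
Qed.

(** The eigenbases of the blocks, transported along [e], form a unitary diagonalising [D]. An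
    arbitrary bijection is allowed because the numbering of a large box does not follow its
    tiles. *)
Lemma eig_count_block (T : finType) m n (e : T * 'I_m -> 'I_n)
    (B : T -> 'M[R]_m) (D : 'M[R]_n) x :
  bijective e -> (forall t, (B t)^T = B t) ->
  (forall t i s j, D (e (t, i)) (e (s, j)) = (t == s)%:R * B t i j) ->
  eig_count D x = (\sum_t eig_count (B t) x)%N.
Proof.
move=> eb sB DB; have [f eK fK] := eb.
have /choice[Q /choice[d Qd]] : forall t, exists Q, exists d, spectral_dec (B t) Q d.
  by move=> t; exact: symmetric_spectral.
have sum_e (F : 'I_n -> R[i]) : \sum_k F k = \sum_t \sum_i F (e (t, i)).
  rewrite pair_big /= (reindex e) /=; last exact: onW_bij.
  by apply: eq_bigr => -[].
pose Q' : 'M[R[i]]_n :=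
  \matrix_(k, l) (((f k).1 == (f l).1)%:R * Q (f k).1 (f k).2 (f l).2).
have Q'e t i s j : Q' (e (t, i)) (e (s, j)) = (t == s)%:R * Q t i j.
  by rewrite mxE !eK.
clearbody Q'; have QD : spectral_dec D Q' (fun k => d (f k).1 (f k).2).
  split.
    apply/unitarymxP/matrixP => k l.
    rewrite -[k]fK -[l]fK; case: (f k) (f l) => t i [s j].
    rewrite !mxE sum_e (bigD1 t) //= [X in _ + X]big1 ?addr0; last first.
      move=> u ut; rewrite big1 // => h _.
      by rewrite Q'e eq_sym (negbTE ut) !mul0r.
    under eq_bigr => h _ do rewrite Q'e eqxx mul1r !mxE Q'e.
    rewrite (inj_eq (bij_inj eb)) xpair_eqE [s == t]eq_sym.
    have [<-|ts] := eqVneq t s; last first.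
      by rewrite /= big1 // => h _; rewrite mul0r rmorph0 mulr0.
    have /unitarymxP/matrixP/(_ i j) := (Qd t).1; rewrite !mxE => <- /=.
    by apply: eq_bigr => h _; rewrite !mxE mul1r.
  apply/matrixP => k l; rewrite -[k]fK -[l]fK; case: (f k) (f l) => t i [s j].
  rewrite mul_mx_diag !mxE DB.
  rewrite sum_e (bigD1 t) //= [X in _ + X]big1 ?addr0; last first.
    move=> u ut; rewrite big1 // => h _.
    by rewrite !mxE Q'e (negbTE ut) mul0r rmorph0 !mul0r.
  under eq_bigr => h _ do rewrite !mxE !Q'e eK /= eqxx mul1r.
  have [_|_] := eqVneq t s; last first.
    by rewrite mul0r rmorph0 big1 // => h _; rewrite mul0r mulr0.
  have /matrixP/(_ i j) := (Qd t).2; rewrite mul_mx_diag !mxE mul1r => ->.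
  by apply: eq_bigr => h _; rewrite !mxE mul1r.
rewrite (eig_count_spectral _ QD).
under eq_bigr => t _ do rewrite (eig_count_spectral _ (Qd t)) -sum1_card big_mkcond /=.
rewrite pair_big /= -sum1_card big_mkcond /= (reindex e) /=; last exact: onW_bij.
by apply: eq_bigr => -[t i] _; rewrite !inE eK.
Qed.

End SpectralDecomposition.

End EigenvalueCount.

(** * Variance of functions with bounded differences *)

Section FiniteProduct.
Context {R : realFieldType} {I X : finType} (p : X -> R).
Hypothesis p_ge0 : forall y, 0 <= p y.
Hypothesis p_sum1 : \sum_y p y = 1.

Implicit Types (F G : {ffun I -> X} -> R) (x : {ffun I -> X}).

Definition iid_weight x : R := \prod_i p (x i).

Definition iid_mean F : R := \sum_x iid_weight x * F x.

Definition ffun_upd x (i : I) (y : X) : {ffun I -> X} :=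
  [ffun j => if j == i then y else x j].

(** The conditional expectation given all coordinates other than [i]. *)
Definition iid_avg (i : I) F x : R := \sum_y p y * F (ffun_upd x i y).

Definition bounded_diff (c : R) F :=
  forall x i y, `|F (ffun_upd x i y) - F x| <= c.

Lemma ffun_upd_upd x i y z : ffun_upd (ffun_upd x i y) i z = ffun_upd x i z.
Proof. by apply/ffunP => j; rewrite !ffunE; case: eqP. Qed.

Lemma ffun_upd_id x i : ffun_upd x i (x i) = x.
Proof. by apply/ffunP => j; rewrite !ffunE; case: eqP => [->|]. Qed.

Lemma ffun_updC x i j y z : i != j ->
  ffun_upd (ffun_upd x i y) j z = ffun_upd (ffun_upd x j z) i y.
Proof.
move=> ij; apply/ffunP => k; rewrite !ffunE.
by case: eqP => // ->; rewrite eq_sym (negbTE ij).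
Qed.

Lemma iid_weight_ge0 x : 0 <= iid_weight x.
Proof. exact: prodr_ge0. Qed.

Lemma iid_weight_upd x i y :
  iid_weight (ffun_upd x i y) * p (x i) = iid_weight x * p y.
Proof.
rewrite /iid_weight (bigD1 i) //= [in RHS](bigD1 i) //= ffunE eqxx.
rewrite (eq_bigr (fun j => p (x j))) => [|j /negbTE ji]; last by rewrite ffunE ji.
by ring.
Qed.

(* The law of (x, y), y an independent copy of a coordinate, is invariant under
   exchanging y with the coordinate i of x. *)
Lemma iid_mean_avg i F : iid_mean (iid_avg i F) = iid_mean F.
Proof.
rewrite /iid_mean; under eq_bigr do rewrite mulr_sumr.
rewrite pair_big /=.
pose sw (z : {ffun I -> X} * X) := (ffun_upd z.1 i z.2, z.1 i).
have swK : involutive sw.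
  by move=> [x y]; rewrite /sw /= ffun_upd_upd ffun_upd_id ffunE eqxx.
rewrite (reindex_inj (inv_inj swK)) /=.
rewrite (eq_bigr (fun z => (iid_weight z.1 * F z.1) * p z.2)).
  rewrite -(pair_big xpredT xpredT (fun x y => iid_weight x * F x * p y)) /=.
  by apply: eq_bigr => x _; rewrite -mulr_sumr p_sum1 mulr1.
move=> [x y] _ /=; rewrite ffun_upd_upd ffun_upd_id mulrA iid_weight_upd.
by ring.
Qed.

Lemma iid_avg_upd i F x y : iid_avg i F (ffun_upd x i y) = iid_avg i F x.
Proof. by apply: eq_bigr => z _; rewrite ffun_upd_upd. Qed.

Lemma iid_avg_mull i F G :
  (forall x y, G (ffun_upd x i y) = G x) ->
  forall x, iid_avg i (fun x => F x * G x) x = iid_avg i F x * G x.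
Proof.
by move=> Gi x; rewrite mulr_suml; apply: eq_bigr => y _; rewrite Gi mulrA.
Qed.

Lemma iid_meanD F G : iid_mean (fun x => F x + G x) = iid_mean F + iid_mean G.
Proof. by rewrite /iid_mean -big_split; apply: eq_bigr => x _; rewrite mulrDr. Qed.

Lemma iid_mean_le F G : (forall x, F x <= G x) -> iid_mean F <= iid_mean G.
Proof.
by move=> FG; apply: ler_sum => x _; rewrite ler_wpM2l // iid_weight_ge0.
Qed.

Lemma iid_mean_scale c F : iid_mean (fun x => c * F x) = c * iid_mean F.
Proof. by rewrite /iid_mean mulr_sumr; apply: eq_bigr => x _; ring. Qed.

Lemma iid_meanN F : iid_mean (fun x => - F x) = - iid_mean F.
Proof. by rewrite /iid_mean -sumrN; apply: eq_bigr => x _; rewrite mulrN. Qed.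

Lemma eq_iid_mean F G : F =1 G -> iid_mean F = iid_mean G.
Proof. by move=> FG; apply: eq_bigr => x _; rewrite FG. Qed.

Lemma iid_mean_cst c : iid_mean (fun=> c) = c.
Proof.
rewrite /iid_mean -mulr_suml /iid_weight.
rewrite -(bigA_distr_bigA (fun (_ : I) y => p y)) big1 ?mul1r //.
Qed.

Lemma iid_avg_dist c i F x : bounded_diff c F -> `|iid_avg i F x - F x| <= c.
Proof.
move=> Fc; rewrite /iid_avg -[F x]mul1r -p_sum1 mulr_suml -sumrB.
rewrite (le_trans (ler_norm_sum _ _ _)) // -[c]mul1r -p_sum1 mulr_suml.
apply: ler_sum => y _; rewrite -mulrBr normrM ger0_norm ?p_ge0 //.
by rewrite ler_wpM2l.
Qed.

Lemma bounded_diff_avg c i F : bounded_diff c F -> bounded_diff c (iid_avg i F).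
Proof.
move=> Fc x j y; have [->|ji] := eqVneq j i.
  rewrite iid_avg_upd subrr normr0.
  by have := Fc x i y; apply: le_trans.
rewrite /iid_avg -sumrB (le_trans (ler_norm_sum _ _ _)) //.
rewrite -[c]mul1r -p_sum1 mulr_suml; apply: ler_sum => z _.
rewrite -mulrBr normrM ger0_norm ?p_ge0 // ler_wpM2l // ffun_updC //.
Qed.

(** Pythagoras: [iid_avg i] is an orthogonal projection for the inner product [iid_mean (F G)]. *)
Lemma iid_mean_sqr_avg i F : iid_mean (fun x => F x ^+ 2) =
  iid_mean (fun x => iid_avg i F x ^+ 2) +
  iid_mean (fun x => (iid_avg i F x - F x) ^+ 2).
Proof.
rewrite -iid_meanD.
have E : iid_mean (fun x => F x * iid_avg i F x) = iid_mean (fun x => iid_avg i F x ^+ 2).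
  rewrite -(iid_mean_avg i); apply: eq_iid_mean => x.
  by rewrite iid_avg_mull ?expr2 // => z y; exact: iid_avg_upd.
transitivity (iid_mean (fun x => F x ^+ 2) + 2 * (iid_mean (fun x => iid_avg i F x ^+ 2) -
   iid_mean (fun x => F x * iid_avg i F x))); first by rewrite E; ring.
by rewrite -iid_meanN -iid_meanD -iid_mean_scale -iid_meanD; apply: eq_iid_mean => x; ring.
Qed.

(** Coordinates are averaged out one after the other. Averaging preserves bounded differences, so
    each step costs at most [c ^+ 2]. *)
Lemma iid_mean_sqr_le c (s : seq I) F : bounded_diff c F ->
  iid_mean (fun x => F x ^+ 2) <=
  iid_mean (fun x => foldl (fun G i => iid_avg i G) F s x ^+ 2) + (size s)%:R * c ^+ 2.
Proof.
elim: s F => [|i s IH] F Fc /=; first by rewrite mul0r addr0.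
rewrite (iid_mean_sqr_avg i) -[(size s).+1]addn1 natrD mulrDl mul1r addrA lerD //.
  exact/IH/bounded_diff_avg.
rewrite -[leRHS]iid_mean_cst; apply: iid_mean_le => x.
rewrite -real_normK ?num_real // lerXn2r ?nnegrE ?iid_avg_dist //.
by have := Fc x i (x i); apply: le_trans.
Qed.

Lemma iid_mean_foldl s F : iid_mean (foldl (fun G i => iid_avg i G) F s) = iid_mean F.
Proof. by elim: s F => //= i s IH F; rewrite IH iid_mean_avg. Qed.

(** Averaging over [i] erases the dependence on coordinate [i], and later averages do not restore
    it. *)
Lemma iid_foldl_upd s F i x y :
  (forall x y, F (ffun_upd x i y) = F x) \/ i \in s ->
  foldl (fun G i => iid_avg i G) F s (ffun_upd x i y) =
  foldl (fun G i => iid_avg i G) F s x.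
Proof.
elim: s F => [F [Fi|//]|j s IH F /= Fi]; [exact: Fi|apply: IH].
have [->|ij] := eqVneq i j; first by left=> ? ?; exact: iid_avg_upd.
case: Fi => [Fi|]; last by rewrite inE (negbTE ij); right.
by left=> {}x {}y; apply: eq_bigr => z _; rewrite ffun_updC // Fi.
Qed.

Lemma iid_mean_sqr_bound c F : bounded_diff c F ->
  iid_mean (fun x => F x ^+ 2) <= iid_mean F ^+ 2 + #|I|%:R * c ^+ 2.
Proof.
move=> Fc; have := iid_mean_sqr_le (enum I) Fc; rewrite -cardE.
set G := foldl _ F _; suff Gc x : G x = iid_mean F.
  suff -> : iid_mean (fun x => G x ^+ 2) = iid_mean F ^+ 2 by [].
  by rewrite -[RHS]iid_mean_cst; apply: eq_iid_mean => x; rewrite Gc.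
suff Gx z : G z = G x.
  by rewrite -(iid_mean_foldl (enum I)) -/G (eq_iid_mean Gx) iid_mean_cst.
(* [x] is turned into [z] one coordinate at a time, none of which changes [G]. *)
have Gs (s : seq I) : G (foldr (fun i u => ffun_upd u i (z i)) x s) = G x.
  elim: s => //= i s IH; rewrite -[RHS]IH /G iid_foldl_upd //.
  by right; rewrite mem_enum.
rewrite -(Gs (enum I)); congr G; apply/ffunP => j.
have : j \in enum I by rewrite mem_enum.
elim: (enum I) => //= i s IH; rewrite inE ffunE.
by case: eqP => [->|_ /IH].
Qed.

(** The centre [m] is free because it will be the mean of the limiting functional, to which the
    means on finite grids only converge. *)
Lemma iid_mean_dev_bound c m F : bounded_diff c F ->
  iid_mean (fun x => (F x - m) ^+ 2) <= (iid_mean F - m) ^+ 2 + #|I|%:R * c ^+ 2.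
Proof.
move=> Fc; have -> : iid_mean F - m = iid_mean (fun x => F x - m).
  by rewrite (iid_meanD F (fun=> - m)) iid_mean_cst.
by apply: iid_mean_sqr_bound => x i y; rewrite opprB addrA subrK.
Qed.

End FiniteProduct.

(** * Functionals of i.i.d. variables *)

Section BoundedFunctions.
Context {disp : measure_display} {Omega : measurableType disp} {R : realType}.
Variable P : probability Omega R.

Lemma bounded_fun_integrable (Z : Omega -> R) B :
  measurable_fun [set: Omega] Z -> (forall w, `|Z w| <= B) ->
  P.-integrable [set: Omega] (EFin \o Z).
Proof.
move=> mZ ZB; apply: measurable_bounded_integrable => //.
  exact: fin_num_fun_lty.
exists B; split; first exact: num_real.
by move=> M BM w _ /=; rewrite (le_trans (ZB w)) // ltW.
Qed.

Lemma bounded_ae_cvg_Rintegral (Z_ : nat -> Omega -> R) (Z : Omega -> R) B :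
  (forall n, measurable_fun [set: Omega] (Z_ n)) -> measurable_fun [set: Omega] Z ->
  (forall n w, `|Z_ n w| <= B) ->
  {ae P, forall w, Z_ n w @[n --> \oo] --> Z w} ->
  \int[P]_w Z_ n w @[n --> \oo] --> \int[P]_w Z w.
Proof.
move=> mZ mZl ZB Zcvg.
have iB : P.-integrable [set: Omega] (EFin \o cst B).
  exact: finite_measure_integrable_cst.
have [] := @dominated_convergence _ _ _ P setT measurableT
  (fun n => EFin \o Z_ n) (EFin \o Z) (EFin \o cst B) => //.
- by move=> n; apply/measurable_EFinP.
- by apply/measurable_EFinP.
- by apply: filterS Zcvg => w Zw _; apply: cvg_EFin; [exact: nearW|exact: Zw].
- by apply: aeW => w n _ /=; rewrite lee_fin.
move=> iZ _ H; apply: fine_cvg; rewrite fineK //; exact: integrable_fin_num.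
Qed.

Lemma bounded_cvg_Rintegral (Z_ : nat -> Omega -> R) (Z : Omega -> R) B :
  (forall n, measurable_fun [set: Omega] (Z_ n)) ->
  (forall n w, `|Z_ n w| <= B) ->
  (forall w, Z_ n w @[n --> \oo] --> Z w) ->
  \int[P]_w Z_ n w @[n --> \oo] --> \int[P]_w Z w.
Proof.
move=> mZ ZB Zcvg; apply: bounded_ae_cvg_Rintegral ZB _ => //; last exact: aeW.
by apply: (measurable_fun_cvg (h := Z_)) => // w _; exact: Zcvg.
Qed.

Lemma measurable_finite_comp (T : finType) (Y : Omega -> T) (F : T -> R) :
  (forall y, measurable (Y @^-1` [set y])) ->
  measurable_fun [set: Omega] (F \o Y) /\
  \int[P]_w F (Y w) = \sum_y fine (P (Y @^-1` [set y])) * F y.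
Proof.
move=> mY.
have FE w : F (Y w) = \sum_y F y * \1_(Y @^-1` [set y]) w.
  rewrite (bigD1 (Y w)) //= big1 ?addr0.
    by rewrite indicE mem_set // mulr1.
  by move=> y yY; rewrite indicE memNset ?mulr0 // => /= /esym/eqP; apply/negP.
have mt y : measurable_fun [set: Omega] (fun w => F y * \1_(Y @^-1` [set y]) w).
  by apply: measurable_funM => //; exact: measurable_indic.
split.
  rewrite (_ : F \o Y = fun w => \sum_y F y * \1_(Y @^-1` [set y]) w).
    exact: measurable_sum.
  by apply/funext => w; exact: FE.
have it y : P.-integrable [set: Omega] (fun w => (F y * \1_(Y @^-1` [set y]) w)%:E).
  apply: (@bounded_fun_integrable _ `|F y|) => // w.
  by rewrite normrM ler_piMr // indicE; case: (_ \in _); rewrite ?normr1 ?normr0.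
rewrite /Rintegral; under eq_integral do rewrite FE -sumEFin.
rewrite integral_sum // -sum_fine; last by move=> y _; exact: integrable_fin_num.
apply: eq_bigr => y _; under eq_integral do rewrite EFinM.
rewrite integralZl //; last first.
  apply: (@bounded_fun_integrable _ 1) => // w.
  by rewrite indicE; case: (_ \in _); rewrite ?normr1 ?normr0.
by rewrite integral_indic // setIT fineM ?fin_num_measure // mulrC.
Qed.

End BoundedFunctions.

(** * Finite-valued images of i.i.d. variables *)

Section IidLaw.
Context {disp : measure_display} {Omega : measurableType disp} {R : realType}
  {P : probability Omega R} {I : choiceType}.
Context {X : I -> {RV P >-> R}} {mu : set (measurableTypeR R) -> \bar R}.
Hypothesis Xiid : iid_with_law X mu.
Context {T : finType} (q : R -> T).
Hypothesis mq : forall t, measurable (q @^-1` [set t] : set (measurableTypeR R)).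

Definition cell_mass (t : T) : R := fine (mu (q @^-1` [set t])).

Lemma measurable_RV_preimage (i : I) (A : set (measurableTypeR R)) :
  measurable A -> measurable (X i @^-1` A).
Proof. by move=> mA; rewrite -[X in measurable X]setTI; exact: measurable_funPT. Qed.

Lemma cell_massE i t : P (X i @^-1` (q @^-1` [set t])) = (cell_mass t)%:E.
Proof.
rewrite /cell_mass -(Xiid.2 i) // fineK //.
by rewrite /distribution /pushforward fin_num_measure //; exact: measurable_RV_preimage.
Qed.

(** [mu] is a bare set function, known only as the law of the variables; an index [i] is what makes
    the cell masses probabilities. *)
Lemma cell_mass_ge0 (i : I) t : 0 <= cell_mass t.
Proof. by rewrite -lee_fin -(cell_massE i). Qed.

Lemma cell_mass_sum1 (i : I) : \sum_t cell_mass t = 1.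
Proof.
have [_] := measurable_finite_comp P (fun=> 1) (fun t => measurable_RV_preimage i (mq t)).
rewrite Rintegral_cst // [X in fine X]probability_setT mul1r /= => ->.
by apply: eq_bigr => t _; rewrite mulr1 -[LHS]/(fine (_%:E)) -(cell_massE i).
Qed.

Context {J : finType} (s : J -> I).
Hypothesis s_inj : injective s.

Definition cell_vector (w : Omega) : {ffun J -> T} := [ffun j => q (X (s j) w)].

(** The event is put in the shape demanded by [mutually_independent], one set per index in [I];
    [pick] inverts [s] on its image. *)
Lemma cell_vector_preimage x : cell_vector @^-1` [set x] =
  \bigcap_(i in [set` [fset s j | j in J]%fset])
    (X i @^-1` (if [pick j | s j == i] is Some j then q @^-1` [set x j] else setT)).
Proof.
apply/seteqP; split => w /=.
  move=> <- i /= _; case: pickP => [j /eqP <-|] //=.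
  by rewrite ffunE.
move=> Hw; apply/ffunP => j; rewrite ffunE.
have /Hw : [set` [fset s j | j in J]%fset] (s j) by apply/imfsetP; exists j.
by case: pickP => [k /eqP/s_inj ->//|/(_ j)]; rewrite eqxx.
Qed.

Lemma measurable_cell_vector x : measurable (cell_vector @^-1` [set x]).
Proof.
rewrite cell_vector_preimage; apply: fin_bigcap_measurable; first exact: finite_fset.
move=> i _; apply: measurable_RV_preimage.
by case: pickP.
Qed.

Lemma cell_vector_law x : P (cell_vector @^-1` [set x]) = (iid_weight cell_mass x)%:E.
Proof.
rewrite cell_vector_preimage Xiid.1; last by move=> i; case: pickP.
rewrite (perm_big [seq s j | j <- index_enum J]); last first.
  apply: uniq_perm; [exact: fset_uniq|by rewrite map_inj_uniq ?index_enum_uniq|].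
  move=> i; apply/imfsetP/mapP => [[j _ ->]|[j _ ->]]; exists j; by rewrite // mem_index_enum.
rewrite big_map /iid_weight -prodEFin; apply: eq_bigr => j _.
case: pickP => [k /eqP/s_inj ->|/(_ j)]; last by rewrite eqxx.
exact: cell_massE.
Qed.

Lemma cell_vector_mean (F : {ffun J -> T} -> R) :
  measurable_fun [set: Omega] (F \o cell_vector) /\
  \int[P]_w F (cell_vector w) = iid_mean cell_mass F.
Proof.
have [mF ->] := measurable_finite_comp P F measurable_cell_vector.
by split => //; apply: eq_bigr => x _; rewrite cell_vector_law.
Qed.

End IidLaw.

(** * Rounding reals down to a finite grid *)

Section Quantizer.
Context {R : realType}.

(** Spacing [1/(k+1)] over [[-(k+1), k+1)] takes [2 (k+1)^2] points. *)
Definition grid (k : nat) (j : nat) : R := j%:R / k.+1%:R - k.+1%:R.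

(** Encoding a real by the set of grid points below it makes every cell an intersection of
    half-lines and their complements, hence measurable. *)
Definition grid_cell (k : nat) (x : R) : {set 'I_(2 * k.+1 ^ 2)} :=
  [set j : 'I__ | grid k j <= x].

(** The default is the lowest grid point, so it affects the value only for reals below the whole
    grid. *)
Definition grid_val (k : nat) (S : {set 'I_(2 * k.+1 ^ 2)}) : R :=
  \big[Num.max/- k.+1%:R]_(j in S) grid k j.

Lemma measurable_grid_cell k S :
  measurable (grid_cell k @^-1` [set S] : set (measurableTypeR R)).
Proof.
rewrite (_ : _ @^-1` _ = \bigcap_(j : 'I_(2 * k.+1 ^ 2))
   (if j \in S then `[grid k j, +oo[%classic else ~` `[grid k j, +oo[%classic)).
  apply: fin_bigcap_measurable; first exact: finite_finset.
  move=> j _; case: ifP => _; first exact: measurable_itv.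
  by apply: measurableC; exact: measurable_itv.
apply/seteqP; split => x /=.
  by move=> <- j _; rewrite inE; case: ifPn => [h|/negP h]; rewrite /= in_itv /= andbT.
move=> H; apply/setP => j; have := H j I; rewrite inE.
by case: (j \in S) => /=; rewrite in_itv /= andbT => // /negP/negbTE.
Qed.

Lemma grid_val_bounds k x : `|x| < k.+1%:R ->
  x - k.+1%:R^-1 <= grid_val (grid_cell k x) <= x.
Proof.
move=> xk; have k0 : (0 : R) < k.+1%:R by [].
have /andP[xl xr] : - k.+1%:R < x < k.+1%:R by rewrite -ltr_norml.
have y0 : 0 <= k.+1%:R * (x + k.+1%:R) by rewrite mulr_ge0 //; lra.
(* The index of the largest grid point below [x], found by solving [grid k j <= x] for [j]. *)
have := truncn_itv y0; set j := Num.truncn _ => /andP[jl jr].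
have jlt : (j < 2 * k.+1 ^ 2)%N.
  rewrite -(ltr_nat R) (le_lt_trans jl) // natrM natrX.
  by rewrite expr2 mulrA [2 * _]mulrC -mulrA ltr_pM2l //; lra.
apply/andP; split; last first.
  apply: bigmax_le => [|i]; first by rewrite ltW.
  by rewrite inE.
apply: (@le_trans _ _ (grid k j)).
  rewrite /grid -(ler_pM2l k0) 2!mulrBr mulfV ?gt_eqF // mulrCA mulfV ?gt_eqF // mulr1.
  by rewrite -natr1 in jr; nra.
rewrite /grid_val; apply: (le_bigmax_cond _ (fun i : 'I_(2 * k.+1 ^ 2) => grid k i)
  (j := Ordinal jlt)).
rewrite inE /grid /= lerBlDr ler_pdivrMr // [leRHS]mulrC //.
Qed.

(** Only eventually: for [x < -(k+1)] the default value exceeds [x]. *)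
Lemma grid_val_le x : \forall k \near \oo, grid_val (grid_cell k x) <= x.
Proof.
near=> k; suff /grid_val_bounds/andP[] : `|x| < k.+1%:R by [].
rewrite (lt_le_trans (truncnS_gt _)) // ler_nat ltnS.
by near: k; exact: nbhs_infty_ge.
Unshelve. all: end_near. Qed.

Lemma grid_val_cvg x : grid_val (grid_cell k x) @[k --> \oo] --> x.
Proof.
apply: (@squeeze_cvgr _ _ _ _ (fun k => x - k.+1%:R^-1) (fun=> x)).
- near=> k; apply: grid_val_bounds.
  rewrite (lt_le_trans (truncnS_gt _)) // ler_nat ltnS.
  by near: k; exact: nbhs_infty_ge.
- by rewrite -[X in _ --> X]subr0; apply: cvgB; [exact: cvg_cst|exact: cvg_harmonic].
- exact: cvg_cst.
Unshelve. all: end_near. Qed.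

End Quantizer.

(* Eigenvalue counts [#{ev <= x}] are not continuous in the potential, only
   continuous from below; hence the variables are rounded down to a finite grid,
   which reduces every claim to a finite product space. *)
Section IidFunctionals.
Context {disp : measure_display} {Omega : measurableType disp} {R : realType}
  {P : probability Omega R} {I : choiceType}.
Context {X : I -> {RV P >-> R}} {mu : set (measurableTypeR R) -> \bar R}.
Hypothesis Xiid : iid_with_law X mu.
Variable i0 : I.
Context {J : finType} (Phi : (J -> R) -> R) (c B : R).
Hypothesis Phi_diff : forall v w j,
  (forall i, i != j -> v i = w i) -> `|Phi v - Phi w| <= c.
Hypothesis Phi_bound : forall v, `|Phi v| <= B.
Hypothesis Phi_left_continuous : forall (u : nat -> J -> R) v,
  (forall j, \forall k \near \oo, u k j <= v j) ->
  (forall j, u k j @[k --> \oo] --> v j) -> Phi (u k) @[k --> \oo] --> Phi v.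

Let Phi_grid (k : nat) (x : {ffun J -> {set 'I_(2 * k.+1 ^ 2)}}) : R :=
  Phi (fun j => grid_val (x j)).

Let Phi_k (s : J -> I) (k : nat) (w : Omega) : R :=
  Phi_grid (cell_vector (X := X) (grid_cell k) s w).

Let Phi_k_cvg s w : Phi_k s k w @[k --> \oo] --> Phi (fun j => X (s j) w).
Proof.
apply: Phi_left_continuous => j.
  by near=> k; rewrite ffunE; near: k; exact: grid_val_le.
by under eq_fun do rewrite ffunE; exact: grid_val_cvg.
Unshelve. all: end_near. Qed.

Let Phi_k_mean s k : injective s ->
  measurable_fun [set: Omega] (Phi_k s k) /\
  \int[P]_w Phi_k s k w = iid_mean (cell_mass (mu := mu) (grid_cell k)) (@Phi_grid k).
Proof.
move=> sI.
have mq : forall S, measurable (grid_cell k @^-1` [set S] : set (measurableTypeR R)).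
  by move=> S; exact: measurable_grid_cell.
exact: (cell_vector_mean Xiid mq sI).
Qed.

Lemma iid_functional_measurable s : injective s ->
  measurable_fun [set: Omega] (fun w => Phi (fun j => X (s j) w)).
Proof.
move=> sI; apply: (measurable_fun_cvg (h := Phi_k s)).
  by move=> k; exact: (Phi_k_mean k sI).1.
by move=> w _; exact: Phi_k_cvg.
Qed.

Let mean_cvg s : injective s ->
  iid_mean (cell_mass (mu := mu) (grid_cell k)) (@Phi_grid k) @[k --> \oo] -->
  \int[P]_w Phi (fun j => X (s j) w).
Proof.
move=> sI; under eq_fun => k do rewrite -(Phi_k_mean k sI).2.
apply: (bounded_cvg_Rintegral (B := B)) => [k|k w|w]; last exact: Phi_k_cvg.
  exact: (Phi_k_mean k sI).1.
exact: Phi_bound.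
Qed.

(** On each grid the mean is computed from the cell masses alone, in which [s] does not occur; both
    integrals are limits of the same sequence. *)
Lemma iid_functional_mean s s' : injective s -> injective s' ->
  \int[P]_w Phi (fun j => X (s j) w) = \int[P]_w Phi (fun j => X (s' j) w).
Proof.
move=> sI s'I; apply: cvg_unique (mean_cvg sI) (mean_cvg s'I).
exact: norm_hausdorff.
Qed.

Lemma iid_functional_variance s (m := \int[P]_w Phi (fun j => X (s j) w)) :
  injective s ->
  \int[P]_w (Phi (fun j => X (s j) w) - m) ^+ 2 <= #|J|%:R * c ^+ 2.
Proof.
move=> sI.
have mPhi k : measurable_fun [set: Omega] (Phi_k s k) := (Phi_k_mean k sI).1.
have cv : \int[P]_w (Phi_k s k w - m) ^+ 2 @[k --> \oo] -->
    \int[P]_w (Phi (fun j => X (s j) w) - m) ^+ 2.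
  apply: (bounded_cvg_Rintegral (B := (B + `|m|) ^+ 2)) => [k|k w|w].
  - by apply: measurable_funX; apply: measurable_funB.
  - rewrite normrX lerXn2r ?nnegrE ?addr_ge0 //.
      by rewrite (le_trans _ (Phi_bound (fun=> 0))).
    by rewrite (le_trans (ler_normB _ _)) // lerD2r Phi_bound.
  - under eq_fun do rewrite expr2; rewrite expr2.
    by apply: cvgM; (apply: cvgB; [exact: Phi_k_cvg|exact: cvg_cst]).
(* The grid mean differs from [m], but the squared difference vanishes in the limit. *)
have m_cvg : (iid_mean (cell_mass (mu := mu) (grid_cell k)) (@Phi_grid k) - m) ^+ 2
    + #|J|%:R * c ^+ 2 @[k --> \oo] --> #|J|%:R * c ^+ 2.
  rewrite -[X in _ --> X]add0r; apply: cvgD; last exact: cvg_cst.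
  under eq_fun do rewrite expr2; rewrite -[0](mulr0 0) -(subrr m).
  by apply: cvgM; (apply: cvgB; [exact: mean_cvg|exact: cvg_cst]).
rewrite -(cvg_lim _ cv) // -(cvg_lim _ m_cvg) //.
apply: ler_lim; [exact: cvgP cv|exact: cvgP m_cvg|apply: nearW => k].
have mq : forall S, measurable (grid_cell k @^-1` [set S] : set (measurableTypeR R)).
  by move=> S; exact: measurable_grid_cell.
rewrite (cell_vector_mean Xiid mq sI (fun x => (Phi_grid x - m) ^+ 2)).2.
apply: iid_mean_dev_bound.
- exact: (cell_mass_ge0 Xiid mq i0).
- exact: (cell_mass_sum1 Xiid mq i0).
- move=> x j y; apply: (Phi_diff (j := j)) => i ij.
  by rewrite ffunE (negbTE ij).
Qed.

End IidFunctionals.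

(** * Eigenvalue counts of the Anderson model in boxes *)

Lemma eventually_no_mem_gt {R : realFieldType} (s : seq R) (x : R) :
  exists2 e, 0 < e & forall y, y \in s -> y <= x + e -> y <= x.
Proof.
elim: s => [|z s [e e0 se]]; first by exists 1.
exists (if z <= x then e else Num.min e ((z - x) / 2)).
  by case: ifPn => //; rewrite -ltNge lt_min e0 => ?; rewrite divr_gt0 // subr_gt0.
move=> y; rewrite inE => /orP[/eqP ->|ys].
  by case: ifPn => //; rewrite -ltNge => xz; rewrite -lerBlDl le_min => /andP[_]; lra.
move=> h; apply: se => //; apply: le_trans h _; rewrite lerD2l.
by case: ifP => // _; rewrite ge_min lexx.
Qed.

Section BoxCount.
Context {R : realType} {d : nat}.
Local Notation Zd := 'rV[int]_d.

(** The potential is an arbitrary vector indexed by the box, so that the count is a functional of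
    finitely many reals and translated boxes share it. *)
Definition box_matrix (L : nat) (u : 'I_(box_card L) -> R) : 'M[R]_(box_card L) :=
  anderson_box (d := d) (fun=> 0) L + diag_mx (\row_i u i).

Definition box_count (L : nat) (x : R) (u : 'I_(@box_card d L) -> R) : R :=
  (eig_count (box_matrix u) x)%:R.

Lemma anderson_box_matrix (v : Zd -> R) L :
  anderson_box v L = box_matrix (fun i => v (site i)).
Proof.
apply/matrixP => i j; rewrite /box_matrix anderson_boxE [RHS]mxE anderson_boxE.
rewrite mulr0 addr0 !mxE mulr_natl; congr (_ + _).
Qed.

Lemma box_matrix_sym L (u : 'I_(box_card L) -> R) : (box_matrix u)^T = box_matrix u.
Proof. by rewrite /box_matrix linearD /= tr_diag_mx anderson_box_sym. Qed.

Lemma eig_count_le_size n (A : 'M[R]_n) x : A^T = A -> (eig_count A x <= n)%N.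
Proof. by move=> sA; rewrite -[leqRHS](size_eigenvalues sA) count_size. Qed.

Lemma box_count_bound L x (u : 'I_(box_card L) -> R) :
  `|box_count x u| <= (box_card (d := d) L)%:R.
Proof. by rewrite ger0_norm // ler_nat eig_count_le_size // box_matrix_sym. Qed.

Lemma box_count_diff L x (u v : 'I_(box_card L) -> R) j :
  (forall i, i != j -> u i = v i) -> `|box_count x u - box_count x v| <= 1.
Proof.
have key (a b : 'I_(box_card L) -> R) : (forall i, i != j -> a i = b i) ->
    (eig_count (box_matrix a) x <= (eig_count (box_matrix b) x).+1)%N.
  move=> ab; rewrite -addn1.
  apply: leq_trans (eig_count_rank x (box_matrix_sym a) (box_matrix_sym b)) _.
  rewrite leq_add2l -[leqRHS](card1 j); apply: mxrank_sparse => i k ij.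
  rewrite /box_matrix opprD addrACA subrr add0r !mxE ab ?subrr //.
move=> uv; rewrite ler_distl; apply/andP; split.
  by rewrite lerBlDr natr1 ler_nat key // => i /uv.
by rewrite natr1 ler_nat key.
Qed.

(** Lowering the potential can only raise the count, and lowering it by at most [e] raises it no
    more than raising the level by [e] does. For [e] below the gap to the next eigenvalue this
    changes nothing. *)
Lemma box_count_left_continuous L x (u : nat -> 'I_(box_card L) -> R) v :
  (forall j, \forall k \near \oo, u k j <= v j) ->
  (forall j, u k j @[k --> \oo] --> v j) ->
  box_count x (u k) @[k --> \oo] --> box_count x v.
Proof.
move=> uv ucv.
have [e e0 sE] := eventually_no_mem_gt (eigenvalues (box_matrix v)) x.
apply: cvg_near_cst; near=> k.
have uvk : forall j, u k j <= v j.
  by near: k; apply: filter_forall => j; exact: uv.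
have vuk : forall j, v j - e <= u k j.
  near: k; apply: filter_forall => j; near=> k; apply/ltW.
  by near: k; apply: (cvgr_gt _ (ucv j)); rewrite ltrBlDr ltrDl.
congr (_%:R); apply/eqP; rewrite eqn_leq; apply/andP; split.
  rewrite -(eig_count_shift e x) ?box_matrix_sym //.
  apply: (@leq_trans (eig_count (box_matrix v) (x + e))); last first.
    rewrite eq_leq //; apply: eq_in_count => y yv; apply/idP/idP; first exact: sE.
    by move=> /le_trans; apply; rewrite lerDl ltW.
  (* Since [u k >= v - e], the matrix of [u k] shifted up by [e] dominates that of [v]. *)
  have := eig_count_diag_le (e := fun j => u k j - (v j - e)) (x + e) (box_matrix_sym v).
  rewrite (_ : box_matrix v + _ = box_matrix (u k) + e%:M).
    by apply=> j; rewrite subr_ge0.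
  by apply/matrixP => i j; rewrite !mxE; case: eqP => _; rewrite ?mulr1n ?mulr0n; ring.
have := eig_count_diag_le (e := fun j => v j - u k j) x (box_matrix_sym (u k)).
rewrite (_ : box_matrix (u k) + _ = box_matrix v).
  by apply=> j; rewrite subr_ge0.
by apply/matrixP => i j; rewrite !mxE; case: eqP => _; rewrite ?mulr1n ?mulr0n; ring.
Unshelve. all: end_near. Qed.

End BoxCount.

(** * Cutting a large box into tiles *)

Section Tiling.
Context {R : realType} {d : nat} (L k : nat).
Local Notation Zd := 'rV[int]_d.
Local Notation T := {ffun 'I_d -> 'I_(2 * k + 1)}.
Local Notation L' := (k * (2 * L + 1) + L)%N.

(** The radius [L'] is chosen so that [2L'+1 = (2k+1)(2L+1)]: translates of the small box fill the
    large one exactly. Subtracting [k] centres the index. *)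
Definition tile_center (t : T) : Zd :=
  \row_a (((t a)%:Z - k%:Z) * (2 * L + 1)%:Z).

Lemma site_bound L0 (i : 'I_(@box_card d L0)) a :
  - L0%:Z <= site i 0 a <= L0%:Z.
Proof. by rewrite mxE; have := ltn_ord (enum_val i a); lia. Qed.

Lemma tile_site_exists (p : T * 'I_(@box_card d L)) :
  exists i : 'I_(@box_card d L'), site i = tile_center p.1 + site p.2.
Proof.
have [_ _ surj] := @site_bij d L'; have [|i _ <-] := surj (tile_center p.1 + site p.2).
  move=> a; rewrite !mxE.
  have := ltn_ord (p.1 a); have := ltn_ord (enum_val p.2 a); nia.
by exists i.
Qed.

Definition tile_site (p : T * 'I_(@box_card d L)) : 'I_(@box_card d L') :=
  projT1 (cid (tile_site_exists p)).

Lemma site_tile_site t i : site (tile_site (t, i)) = tile_center t + site i.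
Proof. by rewrite /tile_site; case: cid. Qed.

(** Injectivity is uniqueness of division by [2L+1] with remainder in [[-L, L]], coordinate by
    coordinate; the cardinalities agree. *)
Lemma tile_site_bij : bijective tile_site.
Proof.
apply: inj_card_bij; last first.
  rewrite card_ord card_prod card_ffun !card_ord !box_cardE -expnMn.
  by apply: eq_leq; congr (_ ^ _)%N; lia.
move=> [t i] [s j] /(congr1 (@site d _)); rewrite !site_tile_site => /rowP e.
have ts : t = s.
  apply/ffunP => a; apply/val_inj => /=; have := e a; have := site_bound i a.
  have := site_bound j a; rewrite 2![(_ + _ : 'rV__) _ _]mxE ![tile_center _ _ _]mxE.
  move: (site i 0 a) (site j 0 a) => x y; nia.
congr (_, _); first exact: ts.
by apply: site_inj; apply/rowP => a; have := e a; rewrite ts 2![(_ + _ : 'rV__) _ _]mxE => /addrI.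
Qed.

(** [enum_val] stores coordinates shifted by [L], so 0 and [2L] are the two faces of the tile. *)
Definition tile_boundary : pred 'I_(@box_card d L) :=
  fun i => [exists a, (enum_val i a == 0%N :> nat) || (enum_val i a == (2 * L)%N :> nat)].

(** A union bound over directions [a]: the pair of faces normal to [a] is a product set with at most
    two values in factor [a] and free other factors. *)
Lemma card_tile_boundary : (#|tile_boundary| <= d * (2 * (2 * L + 1) ^ d.-1))%N.
Proof.
pose G (a b : 'I_d) : {pred 'I_(2 * L).+1} := [pred y | (b != a) || ((y == ord0) || (y == ord_max))].
pose F (a : 'I_d) : pred {ffun 'I_d -> 'I_(2 * L).+1} := family (G a).
have cF a : (#|F a| <= 2 * (2 * L + 1) ^ d.-1)%N.
  rewrite card_family foldrE big_map big_enum /= (bigD1 a) //= leq_mul //.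
    rewrite (eq_card (B := pred2 ord0 ord_max)) ?card2; last by move=> y; rewrite !inE eqxx.
    by case: (_ == _).
  rewrite (eq_bigr (fun=> (2 * L + 1)%N)) => [|b ba].
    by rewrite prod_nat_const cardC1 card_ord.
  by rewrite (eq_card (B := predT)) ?card_ord ?addn1 // => y; rewrite !inE ba.
have -> : #|tile_boundary| = #|[pred g | [exists a, F a g]]|.
  rewrite -!sum1_card [RHS](reindex (@enum_val {ffun 'I_d -> 'I_(2 * L).+1} predT)) /=; last first.
    by apply: onW_bij; exact: enum_val_bij.
  apply: eq_bigl => i; rewrite !inE; apply: eq_existsb => a.
  apply/idP/familyP => [h b|/(_ a)].
    by rewrite inE; case: eqP => [->|].
  by rewrite inE eqxx.
apply: (@leq_trans (\sum_(a : 'I_d) #|F a|)%N); last first.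
  apply: (@leq_trans (\sum_(a : 'I_d) (2 * (2 * L + 1) ^ d.-1))%N).
    by apply: leq_sum => a _; exact: cF.
  by rewrite sum_nat_const card_ord.
rewrite -sum1_card big_mkcond /=.
under [leqRHS]eq_bigr => a _ do rewrite -sum1_card big_mkcond /=.
rewrite exchange_big /=; apply: leq_sum => g _.
by case: ifP => // /existsP[a Fa]; rewrite (bigD1 a) //= [g \in F a]Fa.
Qed.

(** In a direction where the tiles differ the centres are at least [2L+1] apart, so a site off both
    faces is at distance at least 2 from the other tile. *)
Lemma tile_neighbours t i s j : t != s ->
  l1norm (site (tile_site (s, j)) - site (tile_site (t, i))) = 1 :> int ->
  i \in tile_boundary.
Proof.
move=> ts l1; have [a tsa] : exists a, t a != s a.
  apply/existsP; apply: contraNT ts; rewrite negb_exists => /forallP h.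
  by apply/eqP/ffunP => a; apply/eqP; have := h a; rewrite negbK.
have : `|(site (tile_site (s, j)) - site (tile_site (t, i))) 0 a| <=
    l1norm (site (tile_site (s, j)) - site (tile_site (t, i))).
  by rewrite /l1norm (bigD1 a) //= lerDl sumr_ge0.
rewrite l1 !site_tile_site; apply: contraTT => /existsPn/(_ a); rewrite negb_or => /andP[i0 iL].
have := ltn_ord (enum_val j a); have := ltn_ord (enum_val i a).
have tsa' : (t a != s a :> nat) by [].
rewrite !mxE; move: (enum_val i a : nat) (enum_val j a : nat) (t a : nat) (s a : nat) tsa' i0 iL.
rewrite /=; nia.
Qed.

(** [D] is the large matrix with the hopping between tiles deleted. Its blocks are boxes with
    translated potential, and [A - D] lives on boundary rows. *)
Lemma eig_count_tiling (v : Zd -> R) x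
    (S := (\sum_(t : T) eig_count (anderson_box (fun n => v (n + tile_center t)%R) L) x)%N)
    (r := ((2 * k + 1) ^ d * (d * (2 * (2 * L + 1) ^ d.-1)))%N) :
  (eig_count (anderson_box v L') x <= S + r /\
   S <= eig_count (anderson_box v L') x + r)%N.
Proof.
have [f eK fK] := tile_site_bij.
have [A AE] : {A | A = anderson_box v L'} by exists (anderson_box v L').
rewrite -AE; pose D : 'M[R]_(box_card L') := \matrix_(p, q) (((f p).1 == (f q).1)%:R * A p q).
have sA : A^T = A by rewrite AE anderson_box_sym.
have sD : D^T = D.
  by apply/matrixP => p q; rewrite !mxE eq_sym -{1}sA mxE.
have DS : eig_count D x = S.
  apply: (eig_count_block _ tile_site_bij) => [t|t i s j]; first exact: anderson_box_sym.
  rewrite mxE !eK /=; have [<-|_] := eqVneq t s; last by rewrite !mul0r.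
  rewrite !mul1r AE !anderson_boxE (inj_eq (bij_inj tile_site_bij)) xpair_eqE eqxx /=.
  by rewrite !site_tile_site opprD addrACA subrr add0r [tile_center t + _]addrC.
have rk : (\rank (A - D)%R <= r)%N.
  apply: (@leq_trans #|[pred p | (f p).2 \in tile_boundary]|).
    apply: mxrank_sparse => p q; rewrite inE -[p]fK -[q]fK eK.
    case: (f p) (f q) => t i [s j] /= bd; rewrite !mxE !eK /=.
    have [<-|ts] := eqVneq t s; first by rewrite mul1r subrr.
    rewrite mul0r subr0 AE anderson_boxE (inj_eq (bij_inj tile_site_bij)) xpair_eqE.
    rewrite (negbTE ts) mul0r addr0; case: eqP => // l1.
    by rewrite (tile_neighbours ts l1) in bd.
  rewrite -sum1_card big_mkcond /= (reindex tile_site) /=; last exact: onW_bij tile_site_bij.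
  under eq_bigr => p _ do rewrite inE eK.
  rewrite -(pair_big xpredT xpredT (fun (t : T) i => if i \in tile_boundary then 1 else 0)%N) /=.
  rewrite -big_mkcond sum1_card sum_nat_const card_ffun !card_ord.
  by rewrite leq_mul2l card_tile_boundary orbT.
rewrite -DS; split.
  by apply: leq_trans (eig_count_rank x sA sD) _; rewrite leq_add2l.
apply: leq_trans (eig_count_rank x sD sA) _; rewrite leq_add2l.
by rewrite -opprB mxrank_opp.
Qed.

End Tiling.

(** * Vague convergence from intervals *)

Section VagueConvergence.
Context {R : realType}.
Local Notation measureR := {measure set (measurableTypeR R) -> \bar R}.

(** Only [x] is confined to [K]; [y] may leave it. *)
Lemma uniformly_continuous_on_compact (f : R -> R) (K : set R) (e : R) :
  continuous f -> compact K -> 0 < e ->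
  exists2 r, 0 < r & forall x y, K x -> `|x - y| < r -> `|f x - f y| < e.
Proof.
move=> cf cK e0.
pose Q (r : R) (x : R) := forall y, `|x - y| < r -> `|f x - f y| < e.
have ncK : near_covering K by apply/compact_near_coveringP.
have : \forall r \near 0^'+, K `<=` Q r.
  apply: ncK => x Kx.
  have e2 : 0 < e / 2 by rewrite divr_gt0.
  have /cvgrPdist_lt/(_ _ e2)/nbhs_ballP[r /= r0 rf] := cf x.
  have r2 : 0 < r / 2 by rewrite divr_gt0.
  exists (ball x (r / 2), [set t | 0 < t < r / 2]) => /=.
    split; first exact: nbhsx_ballx.
    by near=> t; apply/andP; split; near: t; [exact: nbhs_right_gt|exact: nbhs_right_lt].
  move=> [z t] /= [xz /andP[t0 tr]] y zy.
  have h1 : `|f x - f z| < e / 2.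
    by apply: rf => /=; apply: lt_trans xz _; rewrite ltr_pdivrMr //; lra.
  have h2 : `|f x - f y| < e / 2.
    apply: rf => /=; rewrite -ball_normE /= in xz *.
    have -> : x - y = (x - z) + (z - y) by ring.
    by apply: le_lt_trans (ler_normD _ _) _; lra.
  have -> : f z - f y = - (f x - f z) + (f x - f y) by ring.
  by apply: le_lt_trans (ler_normD _ _) _; rewrite normrN; lra.
move=> near_r; near (0 : R)^'+ => r.
exists r; first by near: r; exact: nbhs_right_gt.
by move=> x y Kx xy; apply: (near near_r r _ x Kx).
Unshelve. all: end_near. Qed.

Lemma compactly_supported_bound (f : R -> R) :
  continuous f -> compactly_supported f ->
  exists M : nat, (forall x, M%:R <= `|x| -> f x = 0) /\ exists B, forall x, `|f x| <= B.
Proof.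
move=> cf cs; have [N [_ NP]] := compact_bounded cs.
pose M := (Num.truncn (`|N| + 1)).+1.
have Mf x : M%:R <= `|x| -> f x = 0.
  move=> Mx; apply: contrapT => /eqP fx.
  have : `|x| <= `|N| + 1.
    apply: (NP (`|N| + 1)); first by rewrite ltr_pwDr // ler_norm.
    exact: subset_closure.
  by apply/negP; rewrite -ltNge (lt_le_trans _ Mx) // truncnS_gt.
exists M; split => //.
have [B [_ BP]] : bounded_set (f @` `[- M%:R, M%:R]).
  apply: compact_bounded; apply: continuous_compact; last exact: segment_compact.
  exact: continuous_subspaceT.
exists (`|B| + 1) => x; have [/Mf ->|xM] := leP M%:R `|x|.
  by rewrite normr0 addr_ge0.
apply: (BP (`|B| + 1)); first by rewrite ltr_pwDr // ler_norm.
by exists x => //=; rewrite in_itv /= -ler_norml ltW.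
Qed.

Lemma bounded_continuous_integrable (f : R -> R) (B : R) (m : measureR) A :
  continuous f -> (forall x, `|f x| <= B) -> measurable A -> (m A < +oo)%E ->
  m.-integrable A (EFin \o f).
Proof.
move=> cf fB mA mAoo; apply: measurable_bounded_integrable => //.
  by apply: measurable_funTS; exact: continuous_measurable_fun.
exists B; split; first exact: num_real.
by move=> C BC x _ /=; rewrite (le_trans (fB x)) // ltW.
Qed.

Local Notation oc a b := (`]a, b]%classic : set (measurableTypeR R)).

(** The error sees the measure only through its total mass on the interval, so one partition serves
    the whole sequence and its limit. Half-open cells are disjoint, whatever the atoms. *)
Lemma Rintegral_riemann_sum (f : R -> R) (B a h e : R) (n : nat) (m : measureR)
    (t := fun i : nat => a + i%:R * h) :
  continuous f -> (forall x, `|f x| <= B) ->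
  0 <= h -> (forall x y, `|x - y| <= h -> `|f x - f y| <= e) ->
  (m (oc (t 0%N) (t n)) < +oo)%E ->
  `|\int[m]_(x in oc (t 0%N) (t n)) f x - \sum_(i < n) f (t i) * fine (m (oc (t i) (t i.+1)))|
    <= e * fine (m (oc (t 0%N) (t n))).
Proof.
move=> cf fB h0 fe.
have t_le i j : (i <= j)%N -> t i <= t j.
  by move=> ij; rewrite lerD2l ler_wpM2r // ler_nat.
elim: n => [_|n IH moo].
  rewrite big_ord0 set_itvoc0 Rintegral_set0 subr0 normr0.
  by rewrite measure0 mulr0.
have U : oc (t 0%N) (t n.+1) = oc (t 0%N) (t n) `|` oc (t n) (t n.+1).
  have t0n := t_le 0%N n (leq0n _); have tnS := t_le n n.+1 (leqnSn _).
  apply/seteqP; split => x /=; rewrite !in_itv /=.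
    by move=> /andP[-> ->]; have [_|_] := leP x (t n); [left|right].
  by case=> /andP[h1 h2]; apply/andP; split => //; lra.
have D : [disjoint oc (t 0%N) (t n) & oc (t n) (t n.+1)].
  apply/disj_setPS => x /= []; rewrite !in_itv /= => /andP[_ xt] /andP[tx _].
  by move: (lt_le_trans tx xt); rewrite ltxx.
have sub A : A `<=` oc (t 0%N) (t n.+1) -> measurable A -> (m A < +oo)%E.
  move=> sA mA; apply: le_lt_trans moo; apply: le_measure => //; rewrite inE //.
have m1 : (m (oc (t 0%N) (t n)) < +oo)%E by apply: sub => //; rewrite U; exact: subsetUl.
have m2 : (m (oc (t n) (t n.+1)) < +oo)%E by apply: sub => //; rewrite U; exact: subsetUr.
have i2 := bounded_continuous_integrable cf fB (measurable_itv `]t n, t n.+1]) m2.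
have -> : fine (m (oc (t 0%N) (t n.+1))) =
    fine (m (oc (t 0%N) (t n))) + fine (m (oc (t n) (t n.+1))).
  rewrite U measureU //; last by apply/disj_set2P.
  by rewrite fineD // ge0_fin_numE.
rewrite U Rintegral_setU //; last first.
  rewrite -U; exact: bounded_continuous_integrable fB _ moo.
rewrite big_ord_recr /= opprD addrACA mulrDr (le_trans (ler_normD _ _)) // lerD ?IH //.
have Ec (c : R) : \int[m]_(x in oc (t n) (t n.+1)) c = c * fine (m (oc (t n) (t n.+1))).
  by rewrite Rintegral_cst.
have ic (c : R) : m.-integrable (oc (t n) (t n.+1)) (EFin \o cst c).
  apply: (@bounded_continuous_integrable _ `|c|) => //; exact: cst_continuous.
have iB : m.-integrable (oc (t n) (t n.+1)) (EFin \o (fun x => f x - f (t n))).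
  apply: (@bounded_continuous_integrable _ (B + `|f (t n)|)) => // x.
    by apply: cvgB; [exact: cf|exact: cvg_cst].
  by rewrite (le_trans (ler_normB _ _)) // lerD2r.
rewrite -!Ec -RintegralB //; last exact: ic.
apply: le_trans (le_normr_Rintegral _ _) _ => //.
apply: le_Rintegral => //; [exact: integrable_norm iB|exact: ic|].
move=> x /=; rewrite in_itv /= => /andP[x1 x2]; apply: fe.
rewrite ger0_norm; last by lra.
have tS : t n.+1 = t n + h by rewrite /t -natr1; ring.
by lra.
Qed.

Lemma vague_cvg_rational_intervals (m : nat -> measureR) (l : measureR) :
  (forall a b : rat, (a < b)%R -> (l (oc (ratr a) (ratr b)) < +oo)%E) ->
  (forall a b : rat, (a < b)%R ->
    m n (oc (ratr a) (ratr b)) @[n --> \oo] --> l (oc (ratr a) (ratr b))) ->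
  vague_cvg m l.
Proof.
move=> loo mcv f cf cs.
have [M0 [Mf [B fB]]] := compactly_supported_bound cf cs.
pose M := M0.+1.
have fM (x : R) : M%:R <= `|x| -> f x = 0.
  by move=> Mx; apply: Mf; apply: le_trans Mx; rewrite ler_nat.
pose W : set (measurableTypeR R) := oc (- M%:R) M%:R.
have M_lt : (- M%:R < M%:R :> rat)%R by apply: (@lt_trans _ _ 0); rewrite ?oppr_lt0 ?ltr0n.
have WE : W = oc (ratr (- M%:R)) (ratr M%:R) by rewrite /W rmorphN /= !ratr_nat.
have mW : measurable W by exact: measurable_itv.
have lW : (l W < +oo)%E by rewrite WE; exact: loo.
have mWcv : m n W @[n --> \oo] --> l W by rewrite WE; exact: mcv.
have mWoo : \forall n \near \oo, (m n W < +oo)%E.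
  have /fine_cvgP[+ _] : m n W @[n --> \oo] --> (fine (l W))%:E.
    by rewrite fineK // ge0_fin_numE.
  by apply: filterS => n; rewrite ge0_fin_numE.
have intE (k : measureR) : (k W < +oo)%E ->
    (\int[k]_x (f x)%:E = (\int[k]_(x in W) f x)%:E)%E.
  move=> kW; rewrite /Rintegral fineK; last first.
    by apply: integrable_fin_num => //; exact: bounded_continuous_integrable fB _ kW.
  rewrite [in RHS]integral_mkcond; apply: eq_integral => x _.
  rewrite patchE; case: ifPn => // /negP; rewrite inE /W /= in_itv /= => xW.
  rewrite fM //; rewrite leNgt; apply/negP; rewrite ltr_norml => /andP[x1 x2].
  by apply: xW; rewrite x1 ltW.
rewrite intE //.
suff: \int[m n]_(x in W) f x @[n --> \oo] --> \int[l]_(x in W) f x.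
  move=> H; apply: (@cvg_trans _ ((\int[m n]_(x in W) f x)%:E @[n --> \oo])).
    by apply: near_eq_cvg; near=> n; rewrite intE //; near: n.
  by apply: cvg_EFin => //; exact: nearW.
have mWr : fine (m n W) @[n --> \oo] --> fine (l W).
  by apply: fine_cvg; rewrite fineK // ge0_fin_numE.
apply/cvgrPdist_le => e e0.
pose C := fine (l W).
have C0 : 0 <= C by exact: fine_ge0.
(* The three errors below are [e' * C], [e'] and [e' * (C + 1)]. *)
pose e' := e / (2 * C + 2).
have e'0 : 0 < e' by rewrite divr_gt0 //; lra.
have [r r0 fr] := uniformly_continuous_on_compact cf (@segment_compact R (- M.+1%:R) M.+1%:R) e'0.
(* The mesh is below [r] for uniform continuity, and below 1 so that if [x] leaves the segment of
   radius [M + 1], then [y] is still outside the support. *)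
pose N := (Num.truncn (2 * M%:R / Num.min r 1)).+1.
pose h : R := 2 * M%:R / N%:R.
have r1 : 0 < Num.min r 1 by rewrite lt_min r0 ltr01.
have hr : h < Num.min r 1.
  rewrite /h ltr_pdivrMr // [ltRHS]mulrC -ltr_pdivrMr //; exact: truncnS_gt.
have h0 : 0 <= h by rewrite divr_ge0 // mulr_ge0.
have fe x y : `|x - y| <= h -> `|f x - f y| <= e'.
  move=> xy; have xyr : `|x - y| < r.
    by apply: le_lt_trans xy (lt_le_trans hr _); rewrite ge_min lexx.
  have [xM|xM] := leP `|x| M.+1%:R.
    by apply/ltW/fr => //=; rewrite in_itv /= -ler_norml.
  have yM : M%:R <= `|y|.
    have : `|x| <= `|x - y| + `|y| by rewrite -[X in `|X| <= _](subrK y) ler_normD.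
    move: xM hr; rewrite lt_min -natr1 => xM /andP[_ h1] xy1; lra.
  rewrite !fM // ?subrr ?normr0 ?ltW //.
  by apply: lt_trans xM; rewrite ltr_nat.
pose t (i : nat) : R := - M%:R + i%:R * h.
have t0 : t 0%N = - M%:R by rewrite /t mul0r addr0.
have tN : t N = M%:R by rewrite /t /h mulrC divfK ?pnatr_eq0 //; ring.
have WT : W = oc (t 0%N) (t N) by rewrite t0 tN.
(* The partition points are rational, so the hypothesis applies to every cell. *)
pose q (i : nat) : rat := - M%:R + i%:R * (2 * M%:R / N%:R).
have tq i : t i = ratr (q i).
  by rewrite /t /q /h rmorphD rmorphN !rmorphM /= fmorphV !ratr_nat rmorph_nat.
have q_lt i : (q i < q i.+1)%R.
  by rewrite ltrD2l ltr_pM2r ?ltr_nat // divr_gt0 // mulr_gt0.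
pose S (k : measureR) := \sum_(i < N) f (t i) * fine (k (oc (t i) (t i.+1))).
have RS (k : measureR) : (k W < +oo)%E ->
    `|\int[k]_(x in W) f x - S k| <= e' * fine (k W).
  by rewrite WT => kW; apply: (Rintegral_riemann_sum cf fB h0 fe).
have Scv : S (m n) @[n --> \oo] --> S l.
  apply: cvg_big => [|i _]; first by move=> z; exact: add_continuous.
  apply: cvgM; first exact: cvg_cst.
  apply: fine_cvg; rewrite !tq fineK; first exact: mcv.
  by rewrite ge0_fin_numE // loo.
near=> n.
have h1 : `|\int[l]_(x in W) f x - S l| <= e' * C by apply: RS.
have mnW : fine (m n W) <= C + 1.
  by near: n; apply: (cvgr_le _ mWr); rewrite ltrDl.
have h2 : `|\int[m n]_(x in W) f x - S (m n)| <= e' * (C + 1).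
  apply: le_trans (RS (m n) _) _; first by near: n.
  by rewrite ler_pM2l.
have h3 : `|S l - S (m n)| <= e'.
  by near: n; move/cvgrPdist_le : Scv; apply.
have -> : e = e' * C + e' + e' * (C + 1).
  by rewrite /e'; field; rewrite gt_eqF //; lra.
have -> : \int[l]_(x in W) f x - \int[m n]_(x in W) f x =
   (\int[l]_(x in W) f x - S l) + (S l - S (m n)) - (\int[m n]_(x in W) f x - S (m n)).
  by ring.
rewrite (le_trans (ler_normB _ _)) // lerD // (le_trans (ler_normD _ _)) // lerD //.
Unshelve. all: end_near. Qed.

End VagueConvergence.

(** * Means and fluctuations of the counts *)

Section AlmostSure.
Context {disp : measure_display} {Omega : measurableType disp} {R : realType}.
Variable P : probability Omega R.

(** The sum of the series has finite mean, hence is finite almost surely, and the terms of a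
    convergent series tend to 0. *)
Lemma ae_cvg0_of_summable_Rintegral (Y : nat -> Omega -> R) (C : R) :
  (forall n w, 0 <= Y n w) ->
  (forall n, P.-integrable [set: Omega] (EFin \o Y n)) ->
  (forall n, \sum_(i < n) \int[P]_w Y i w <= C) ->
  {ae P, forall w, Y n w @[n --> \oo] --> (0 : R)}.
Proof.
move=> Y0 iY YC.
have mY n : measurable_fun [set: Omega] (EFin \o Y n) by case/integrableP: (iY n).
have Y0e n w : (0 <= (EFin \o Y n) w)%E by rewrite lee_fin.
have S0 w : (0 <= \sum_(n <oo) (Y n w)%:E)%E by apply: nneseries_ge0 => n _ _; exact: Y0e.
have iS : P.-integrable [set: Omega] (fun w => \sum_(n <oo) (Y n w)%:E)%E.
  apply/integrableP; split.
    apply: ge0_emeasurable_sum; last by move=> n _; exact: mY.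
    by move=> n w _ _; exact: Y0e.
  rewrite (eq_integral (fun w => \sum_(n <oo) (Y n w)%:E)%E); last first.
    by move=> w _; rewrite gee0_abs.
  rewrite (integral_nneseries P measurableT mY (fun n w _ => Y0e n w)).
  apply: (@le_lt_trans _ _ C%:E); last exact: ltry.
  apply: lime_le.
    by apply: is_cvg_nneseries => n _ _; exact: integral_ge0.
  apply: nearW => n; rewrite big_mkord.
  rewrite (eq_bigr (fun i : 'I_n => (\int[P]_w Y i w)%:E)) => [|i _].
    by rewrite sumEFin lee_fin; exact: YC.
  by rewrite /Rintegral fineK //; exact: (integrable_fin_num measurableT (iY i)).
apply: filterS (integrable_ae measurableT iS) => w /(_ I) fS.
apply: cvg_series_cvg_0; apply: nnseries_is_cvg => //.
rewrite -ge0_fin_numE //; exact: S0.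
Qed.

End AlmostSure.

(** * Powers of the side length *)

Section Asymptotics.
Context {R : realType}.

Lemma powR_box_side_cvg0 (p : R) : 0 < p ->
  ((2 * L + 1)%:R `^ (- p) : R) @[L --> \oo] --> (0 : R).
Proof.
move=> p0; apply/cvgrPdist_lt => e e0.
near=> L; rewrite sub0r normrN ger0_norm ?powR_ge0 //.
have N0 : 0 < (2 * L + 1)%:R :> R by rewrite ltr0n addn1.
have : (e^-1) `^ (p^-1) < (2 * L + 1)%:R.
  rewrite (lt_le_trans (truncnS_gt _)) // ler_nat.
  rewrite addn1 ltnS; apply: (@leq_trans L); last by rewrite leq_pmull.
  by near: L; exact: nbhs_infty_ge.
move=> /(gt0_ltr_powR p0) H.
have : e^-1 < (2 * L + 1)%:R `^ p.
  have := H _ _; rewrite !nnegrE powR_ge0 ltW // => /(_ isT isT).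
  by rewrite -powRrM mulVf ?gt_eqF // powRr1 // invr_ge0 ltW.
by rewrite powRN => h; rewrite invf_plt // ?posrE // powR_gt0.
Unshelve. all: end_near. Qed.

(* The series telescopes: [n^(-3/2) <= 2 (1 / sqrt (n - 1) - 1 / sqrt n)]. *)
Lemma sum_box_side_powR (p : R) n : 3 / 2 <= p ->
  \sum_(L < n) ((2 * L + 1)%:R `^ (- p) : R) <= 3.
Proof.
move=> p32.
have s_gt0 (k : nat) : 0 < Num.sqrt k.+1%:R :> R by rewrite sqrtr_gt0.
have le1 (L : nat) : (2 * L + 1)%:R `^ (- p) <= (Num.sqrt L.+1%:R ^+ 3)^-1 :> R.
  rewrite powRN lef_pV2 ?posrE ?exprn_gt0 ?powR_gt0 ?ltr0n ?addn1 //.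
  have -> : Num.sqrt L.+1%:R ^+ 3 = L.+1%:R `^ (3 / 2) :> R.
    by rewrite -powR12_sqrt // -powR_mulrn ?powR_ge0 // -powRrM mulrC.
  apply: (@le_trans _ _ ((2 * L).+1%:R `^ (3 / 2))).
    by rewrite ge0_ler_powR ?nnegrE // ?ler_nat; (lra || lia).
  by apply: ler_powR => //; rewrite ler1n.
(* The constant 3 makes this an equality for the single term [L = 0]. *)
have le2 k : \sum_(L < k.+1) ((2 * L + 1)%:R `^ (- p) : R) <= 3 - 2 / Num.sqrt k.+1%:R.
  elim: k => [|k IH].
    rewrite big_ord_recr big_ord0 /= add0r (le_trans (le1 0%N)) // sqrtr1 expr1n invr1; lra.
  rewrite big_ord_recr /= (le_trans (lerD IH (le1 _))) //.
  have a0 := s_gt0 k; have b0 := s_gt0 k.+1.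
  have ab : Num.sqrt k.+1%:R <= Num.sqrt k.+2%:R :> R by rewrite ler_wsqrtr // ler_nat.
  have sa : Num.sqrt k.+1%:R ^+ 2 = k.+1%:R :> R by rewrite sqr_sqrtr.
  have sb : Num.sqrt k.+2%:R ^+ 2 = k.+1%:R + 1 :> R by rewrite sqr_sqrtr // natr1.
  move: (Num.sqrt k.+1%:R) (Num.sqrt k.+2%:R) a0 b0 ab sa sb => a b a0 b0 ab sa sb.
  have e1 : (b - a) * (b + a) = 1 by rewrite -subr_sqr sa sb; ring.
  have e2 : 1 <= (b - a) * (2 * b) by rewrite -[X in X <= _]e1 ler_wpM2l ?subr_ge0 //; lra.
  rewrite -subr_ge0.
  have -> : 3 - 2 / b - (3 - 2 / a + (b ^+ 3)^-1) =
      (2 * (b - a) * b ^+ 2 - a) / (a * b ^+ 3).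
    by field; rewrite !gt_eqF.
  rewrite divr_ge0 ?mulr_ge0 ?exprn_ge0 ?(ltW a0) ?(ltW b0) // subr_ge0.
  rewrite (le_trans ab) // -[leLHS]mulr1.
  by rewrite (_ : 2 * (b - a) * b ^+ 2 = b * ((b - a) * (2 * b))) ?ler_pM2l //; ring.
case: n => [|n]; first by rewrite big_ord0.
by rewrite (le_trans (le2 n)) // gerDl oppr_le0 divr_ge0.
Qed.

End Asymptotics.

(** * Mean counts and the integrated density of states *)

Section BoxMean.
Context {R : realType} {d : nat} {disp : measure_display}
  {Omega : measurableType disp} {P : probability Omega R}
  {mu : set (measurableTypeR R) -> \bar R}.
Variable V : 'rV[int]_d -> {RV P >-> R}.
Hypothesis hV : iid_with_law V mu.

Definition random_box_count (L : nat) (x : R) (w : Omega) : R :=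
  box_count x (fun i : 'I_(box_card L) => V (site i) w).

Definition box_mean (L : nat) (x : R) : R := \int[P]_w random_box_count L x w.

Lemma random_box_countE L x w :
  random_box_count L x w = (count (fun y => y <= x) (spectrum_box V L w))%:R.
Proof. by rewrite /random_box_count /box_count -(anderson_box_matrix (fun n => V n w)). Qed.

Lemma measurable_box_count L x (s : 'I_(@box_card d L) -> 'rV[int]_d) : injective s ->
  measurable_fun [set: Omega] (fun w => box_count x (fun i => V (s i) w)).
Proof.
by apply: (iid_functional_measurable hV); exact: box_count_left_continuous.
Qed.

(** Stationarity: both families of sites are injective samples of the same i.i.d. field. *)
Lemma box_mean_shift L x c :
  \int[P]_w box_count x (fun i : 'I_(box_card L) => V (site i + c) w) = box_mean L x.
Proof.
apply: (iid_functional_mean hV (box_count_bound x) (@box_count_left_continuous R d L x)).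
  by move=> i j /addIr; exact: site_inj.
exact: site_inj.
Qed.

Lemma box_variance L x :
  \int[P]_w (random_box_count L x w - box_mean L x) ^+ 2 <= ((2 * L + 1) ^ d)%:R.
Proof.
have := iid_functional_variance hV 0 (@box_count_diff R d L x) (box_count_bound x)
  (@box_count_left_continuous R d L x) (@site_inj d L).
have -> : #|'I_(@box_card d L)| = ((2 * L + 1) ^ d)%N by rewrite card_ord box_cardE.
by rewrite expr1n mulr1.
Qed.

Lemma box_count_integrable L x (s : 'I_(@box_card d L) -> 'rV[int]_d) : injective s ->
  P.-integrable [set: Omega] (EFin \o (fun w => box_count x (fun i => V (s i) w))).
Proof.
move=> sI; apply: (@bounded_fun_integrable _ _ _ P _ ((@box_card d L)%:R)).
  exact: measurable_box_count.
by move=> w; exact: box_count_bound.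
Qed.

Lemma box_mean_tiling L k x :
  `|box_mean (k * (2 * L + 1) + L) x - ((2 * k + 1) ^ d)%:R * box_mean L x| <=
  ((2 * k + 1) ^ d * (d * (2 * (2 * L + 1) ^ d.-1)))%:R.
Proof.
set r := (_ * (d * _))%N.
pose Z t w := box_count x (fun i : 'I_(box_card L) => V (site i + @tile_center d L k t) w).
have siteI t : injective (fun i : 'I_(box_card L) => site i + @tile_center d L k t).
  by move=> i j /addIr; exact: site_inj.
have iZ t : P.-integrable [set: Omega] (EFin \o Z t) by exact: box_count_integrable.
have iS : P.-integrable [set: Omega] (EFin \o (fun w => \sum_t Z t w)).
  apply: (@bounded_fun_integrable _ _ _ P _
    (\sum_(t : {ffun 'I_d -> 'I_(2 * k + 1)}) (@box_card d L)%:R)).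
    by apply: measurable_sum => t; exact: measurable_box_count.
  move=> w; apply: le_trans (ler_norm_sum _ _ _) _.
  by apply: ler_sum => t _; exact: box_count_bound.
have -> : ((2 * k + 1) ^ d)%:R * box_mean L x = \int[P]_w (\sum_t Z t w).
  rewrite /Rintegral; under eq_integral do rewrite -sumEFin.
  rewrite integral_sum // -sum_fine => [|t _]; last first.
    exact: (integrable_fin_num measurableT (iZ t)).
  rewrite (eq_bigr (fun=> box_mean L x)) => [|t _]; last exact: box_mean_shift.
  by rewrite sumr_const card_ffun !card_ord mulr_natl.
have iL : P.-integrable [set: Omega] (EFin \o random_box_count (k * (2 * L + 1) + L) x).
  by apply: box_count_integrable; exact: site_inj.
have iB : P.-integrable [set: Omega]
    (EFin \o (fun w => random_box_count (k * (2 * L + 1) + L) x w - \sum_t Z t w)).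
  exact: (integrableB measurableT iL iS).
rewrite -RintegralB //; apply: le_trans (le_normr_Rintegral _ _) _ => //.
have -> : r%:R = \int[P]_(w in [set: Omega]) (r%:R : R).
  by rewrite Rintegral_cst // [X in fine X]probability_setT mulr1.
apply: le_Rintegral => //; [exact: integrable_norm iB|exact: finite_measure_integrable_cst|].
move=> w _; have [h1 h2] := eig_count_tiling L k (fun n => V n w) x.
have ZE : \sum_t Z t w = (\sum_(t : {ffun 'I_d -> 'I_(2 * k + 1)})
    eig_count (anderson_box (fun n => V (n + tile_center L t)%R w) L) x)%:R.
  by rewrite natr_sum; apply: eq_bigr => t _; rewrite anderson_box_matrix.
rewrite ZE /random_box_count /box_count -(anderson_box_matrix (fun n => V n w)) ler_distl.
by rewrite lerBlDr -!natrD !ler_nat h1 h2.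
Qed.

(** For fixed [L] and growing [k], the mean density of the large box tends to [N x], by dominated
    convergence, while tiling keeps it within [c / (2L+1)^d] of the mean density of one tile. The
    bound passes to the limit. *)
Lemma box_mean_ids (N : R -> R) L x : integrated_dos V N ->
  `|box_mean L x - ((2 * L + 1) ^ d)%:R * N x| <= (d * (2 * (2 * L + 1) ^ d.-1))%:R.
Proof.
move=> hN; set c := (d * _)%N.
pose D (k : nat) : R := ((2 * k + 1) ^ d)%:R.
have D0 k : 0 < D k by rewrite ltr0n expn_gt0 addn1.
have cvgN : (D L')^-1 * box_mean L' x @[L' --> \oo] --> N x.
  have : \int[P]_w ((D L')^-1 * random_box_count L' x w) @[L' --> \oo] -->
      \int[P]_w N x.
    apply: (@bounded_ae_cvg_Rintegral _ _ _ P _ _ 1).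
    - move=> L'; apply: measurable_funM => //.
      by apply: measurable_box_count; exact: site_inj.
    - exact: measurable_cst.
    - move=> L' w; rewrite normrM ger0_norm ?invr_ge0 ?(ltW (D0 _)) //.
      rewrite ler_pdivrMl // mulr1 /D -box_cardE; exact: box_count_bound.
    - apply: filterS (hN x) => w; under eq_fun do rewrite -random_box_countE.
      exact.
  rewrite Rintegral_cst // [X in fine X]probability_setT mulr1.
  apply: cvg_trans; apply: near_eq_cvg; apply: nearW => L'.
  rewrite RintegralZl //; apply: box_count_integrable; exact: site_inj.
(* The large radius is at least [k], so [cvgN] applies along it. *)
have sub : (D (k * (2 * L + 1) + L)%N)^-1 * box_mean (k * (2 * L + 1) + L) x
    @[k --> \oo] --> N x.
  apply: (cvg_comp _ _ _ cvgN) => A [n _ nA]; exists n => // k /= nk.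
  by apply: nA => /=; apply: leq_trans nk _; nia.
have H : `|N x - (D L)^-1 * box_mean L x| <= (D L)^-1 * c%:R.
  have : `|(D (k * (2 * L + 1) + L)%N)^-1 * box_mean (k * (2 * L + 1) + L) x -
     (D L)^-1 * box_mean L x| @[k --> \oo] --> `|N x - (D L)^-1 * box_mean L x|.
    by apply: cvg_norm; apply: cvgB => //; exact: cvg_cst.
  move=> /[dup] cv /cvg_lim <- //; apply: limr_le; first exact: cvgP cv.
  apply: nearW => k.
  have DE : D (k * (2 * L + 1) + L)%N = D k * D L.
    by rewrite /D -natrM -expnMn; congr ((_ ^ _)%N%:R); lia.
  have -> : (D (k * (2 * L + 1) + L)%N)^-1 * box_mean (k * (2 * L + 1) + L) x -
     (D L)^-1 * box_mean L x = (D k * D L)^-1 *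
     (box_mean (k * (2 * L + 1) + L) x - D k * box_mean L x).
    by rewrite DE; field; rewrite !gt_eqF.
  rewrite normrM ger0_norm ?invr_ge0 ?mulr_ge0 ?(ltW (D0 _)) // ler_pdivrMl ?mulr_gt0 //.
  rewrite (le_trans (box_mean_tiling L k x)) // natrM -/(D k) -/c mulrA mulfK ?gt_eqF //.
have -> : box_mean L x - ((2 * L + 1) ^ d)%:R * N x =
    - (D L * (N x - (D L)^-1 * box_mean L x)).
  by rewrite -/(D L); field; rewrite gt_eqF.
by rewrite normrN normrM gtr0_norm // -ler_pdivlMl.
Qed.

End BoxMean.

(** * Increments of the integrated density of states near [E] *)

Section LocalDensity.
Context {R : realType}.

Lemma distribution_increment (rho N : R -> R)
    (nu : {measure set (measurableTypeR R) -> \bar R}) (E e : R) :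
  continuous rho ->
  (forall x : R, nu `]-oo, x]%classic = (N x)%:E) ->
  (forall A : set (measurableTypeR R), measurable A ->
    (nu A = \int[lebesgue_measure]_(x in A) (rho x)%:E)%E) ->
  0 < rho E -> 0 < e ->
  exists2 r, 0 < r & forall y z, `|y - E| < r -> `|z - E| < r -> y <= z ->
    `|N z - N y - rho E * (z - y)| <= e * (z - y).
Proof.
move=> crho nuN nurho rE e0.
(* The bound by [rho E] keeps [rho] nonnegative on the interval, as the comparison of integrals
   requires. *)
pose e' := Num.min e (rho E).
have e'0 : 0 < e' by rewrite lt_min e0.
have e'e : e' <= e by rewrite ge_min lexx.
have e'r : e' <= rho E by rewrite ge_min lexx orbT.
have /cvgrPdist_le/(_ _ e'0)/nbhs_ballP[r /= r0 rr] := crho E.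
exists r => // y z yr zr yz.
pose A : set (measurableTypeR R) := `]y, z]%classic.
have mA : measurable A by exact: measurable_itv.
have rA x : A x -> rho E - e' <= rho x <= rho E + e'.
  rewrite /A /= in_itv /= => /andP[yx xz].
  have : `|rho E - rho x| <= e'.
    apply: rr; rewrite -ball_normE /= ltr_norml.
    by move: yr zr; rewrite !ltr_norml => /andP[? ?] /andP[? ?]; apply/andP; split; lra.
  by rewrite ler_norml => /andP[? ?]; apply/andP; split; lra.
have nuA : (nu A = (N z - N y)%:E)%E.
  have zU : `]-oo, z]%classic = `]-oo, y]%classic `|` A :> set (measurableTypeR R).
    apply/seteqP; split => x; rewrite /A /= !in_itv /=.
      by move=> ->; have [_|_] := leP x y; [left|right].
    by case=> [/le_trans|/andP[_ //]]; apply.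
  have : (nu `]-oo, z]%classic = nu `]-oo, y]%classic + nu A)%E.
    rewrite zU measureU //.
    apply/seteqP; split => x //; rewrite /A /= !in_itv /= => -[xy /andP[yx _]].
    by move: (lt_le_trans yx xy); rewrite ltxx.
  by rewrite !nuN EFinB => ->; rewrite addeAC subee // add0e.
have lebA : (lebesgue_measure A = (z - y)%:E)%E.
  rewrite /A lebesgue_measure_itv /= lte_fin; case: ltP => [//|zy].
  have -> : z = y by apply/eqP; rewrite eq_le yz zy.
  by rewrite subrr.
have mrho : measurable_fun A (EFin \o rho).
  by apply/measurable_EFinP/measurable_funTS; exact: continuous_measurable_fun.
have r0A x : A x -> (0 <= (rho x)%:E)%E.
  by move=> /rA/andP[+ _]; rewrite lee_fin; apply: le_trans; rewrite subr_ge0.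
have lo : (((rho E - e') * (z - y))%:E <= (N z - N y)%:E)%E.
  rewrite -nuA nurho // EFinM -lebA -integral_cst //.
  apply: ge0_le_integral => //.
  - by move=> x _; rewrite lee_fin subr_ge0.
  - by move=> x /rA/andP[+ _]; rewrite lee_fin.
have hi : ((N z - N y)%:E <= ((rho E + e') * (z - y))%:E)%E.
  rewrite -nuA nurho // EFinM -lebA -integral_cst //.
  apply: ge0_le_integral => //.
  by move=> x /rA/andP[_ +]; rewrite lee_fin.
rewrite !lee_fin in lo hi; rewrite ler_norml; apply/andP; split; nra.
Qed.

End LocalDensity.

(** * Counts in rescaled windows *)

Section EigenvalueProcess.
Context {R : realType} {d : nat} {disp : measure_display}
  {Omega : measurableType disp} {P : probability Omega R}
  {mu : set (measurableTypeR R) -> \bar R}.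
Variable V : 'rV[int]_d -> {RV P >-> R}.
Hypothesis hV : iid_with_law V mu.
Variables (gamma E : R).
Local Notation side L := ((2 * L + 1)%:R : R).

Let side_gt0 L : 0 < side L.
Proof. by rewrite ltr0n addn1. Qed.

(** The energy that the rescaling about [E] sends to [a]. *)
Definition window (a : R) (L : nat) : R := E + side L `^ (- gamma) * a.

Lemma eigenvalue_process_itv beta L w (a b : R) : a <= b ->
  eigenvalue_process V gamma beta E L w `]a, b]%classic =
  (side L `^ (- beta) * (random_box_count V L (window b L) w -
                         random_box_count V L (window a L) w))%:E.
Proof.
move=> ab; set s := spectrum_box V L w.
have cE x : random_box_count V L x w = \sum_(i < size s) (s`_i <= x)%R%:R.
  rewrite random_box_countE -/s -sum1_count big_mkcond (big_nth 0) big_mkord natr_sum.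
  by apply: eq_bigr => i _; case: ifP.
rewrite /eigenvalue_process /mscale /= /msum -/s EFinM; congr (_ * _)%E.
rewrite !cE -sumrB -sumEFin; apply: eq_bigr => i _.
rewrite -[LHS]/((\1_(`]a, b]%classic) (side L `^ gamma * (s`_i - E)))%:E) indicE; congr EFin.
have g0 : 0 < side L `^ gamma by rewrite powR_gt0.
have win c : (s`_i <= window c L) = (side L `^ gamma * (s`_i - E) <= c).
  by rewrite /window powRN -lerBlDl ler_pdivlMl.
rewrite !win; have [h|h] := leP (side L `^ gamma * (s`_i - E)) a.
  rewrite (le_trans h ab) subrr memNset //= in_itv /= => /andP[].
  by rewrite ltNge h.
rewrite subr0; congr ((nat_of_bool _)%:R); apply/idP/idP.
  by rewrite inE /= in_itv /= h.
by move=> h'; rewrite inE /= in_itv /= h h'.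
Qed.

(** The variance bound is independent of the level, so the level may move with [L]. *)
Lemma fluctuation_ae_cvg0 (x : nat -> R) : (2 <= d)%N ->
  0 < gamma < (d%:R - 1) / (2 * d%:R) ->
  {ae P, forall w,
    side L `^ (gamma - d%:R) * (random_box_count V L (x L) w - box_mean V L (x L))
      @[L --> \oo] --> (0 : R)}.
Proof.
move=> hd /andP[g0 gd].
have d0 : 0 < d%:R :> R by rewrite ltr0n; lia.
have d2 : 2 <= d%:R :> R by rewrite ler_nat.
(* The hypothesis gives [d - 2 gamma > d - 1 + 1/d], and the right side is at least 3/2 for
   [d >= 2]. *)
have p32 : 3 / 2 <= d%:R - 2 * gamma.
  by move: gd; rewrite ltr_pdivlMr ?mulr_gt0 // => gd; nra.
pose Y L w := (side L `^ (gamma - d%:R) *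
  (random_box_count V L (x L) w - box_mean V L (x L))) ^+ 2.
have mZ L : measurable_fun [set: Omega] (random_box_count V L (x L)).
  by apply: (measurable_box_count hV); exact: site_inj.
have iZ L : P.-integrable [set: Omega]
    (EFin \o (fun w => (random_box_count V L (x L) w - box_mean V L (x L)) ^+ 2)).
  apply: (@bounded_fun_integrable _ _ _ P _ (((@box_card d L)%:R + `|box_mean V L (x L)|) ^+ 2)).
    by apply: measurable_funX; apply: measurable_funB.
  move=> w; rewrite normrX lerXn2r ?nnegrE ?addr_ge0 //.
  by rewrite (le_trans (ler_normB _ _)) // lerD2r; exact: box_count_bound.
have YE L : Y L = (fun w => (side L `^ (gamma - d%:R)) ^+ 2 *
    (random_box_count V L (x L) w - box_mean V L (x L)) ^+ 2).
  by apply/funext => w; rewrite /Y exprMn.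
have : {ae P, forall w, Y L w @[L --> \oo] --> (0 : R)}.
  apply: (ae_cvg0_of_summable_Rintegral (C := 3)) => [L w|L|n].
  - exact: sqr_ge0.
  - rewrite YE; have := integrableZl measurableT ((side L `^ (gamma - d%:R)) ^+ 2) (iZ L).
    exact.
  - apply: le_trans (sum_box_side_powR n p32); apply: ler_sum => L _.
    rewrite YE RintegralZl // opprB.
    apply: (@le_trans _ _ ((side L `^ (gamma - d%:R)) ^+ 2 * ((2 * L + 1) ^ d)%:R)).
      by rewrite ler_wpM2l ?exprn_ge0 // (box_variance hV).
    rewrite natrX -(powR_mulrn d (ltW (side_gt0 L))) -powR_mulrn ?powR_ge0 // -powRrM.
    rewrite -powRD; last by rewrite (gt_eqF (side_gt0 L)) implybT.
    by rewrite (_ : (gamma - d%:R) * 2 + d%:R = 2 * gamma - d%:R) //; ring.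
move=> Ycvg; apply: filterS Ycvg => w Yw; apply/cvgrPdist_lt => e e0.
have e20 : 0 < e ^+ 2 by rewrite exprn_gt0.
move/cvgrPdist_lt : Yw => /(_ _ e20); apply: filterS => L.
by rewrite !sub0r !normrN /Y normrX ltr_pXn2r ?nnegrE ?(ltW e0).
Qed.

Lemma window_ids_cvg (rho N : R -> R)
    (nu : {measure set (measurableTypeR R) -> \bar R}) (a b : R) :
  continuous rho ->
  (forall x : R, nu `]-oo, x]%classic = (N x)%:E) ->
  (forall A : set (measurableTypeR R), measurable A ->
    (nu A = \int[lebesgue_measure]_(x in A) (rho x)%:E)%E) ->
  0 < rho E -> 0 < gamma -> a < b ->
  side L `^ gamma * (N (window b L) - N (window a L)) @[L --> \oo] --> rho E * (b - a).
Proof.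
move=> crho nuN nurho rE g0 ab; apply/cvgrPdist_le => e e0.
have ba0 : 0 < b - a by rewrite subr_gt0.
have [r r0 rN] := distribution_increment crho nuN nurho rE (divr_gt0 e0 ba0).
have near_window c : \forall L \near \oo, `|window c L - E| < r.
  have c0 : side L `^ (- gamma) * c @[L --> \oo] --> 0 * c.
    by apply: cvgM; [exact: powR_box_side_cvg0|exact: cvg_cst].
  move/cvgrPdist_lt : c0 => /(_ _ r0); apply: filterS => L.
  by rewrite mul0r sub0r normrN /window addrC addKr.
near=> L.
have gL : 0 < side L `^ gamma by rewrite powR_gt0.
have wE c : window c L = E + c / side L `^ gamma by rewrite /window powRN mulrC.
have h : window b L - window a L = (b - a) / side L `^ gamma by rewrite !wE; ring.
have wab : window a L <= window b L by rewrite -subr_ge0 h divr_ge0 ?ltW.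
have na : `|window a L - E| < r by near: L; exact: near_window.
have nb : `|window b L - E| < r by near: L; exact: near_window.
have := rN _ _ na nb wab; rewrite h => H.
have -> : rho E * (b - a) - side L `^ gamma * (N (window b L) - N (window a L)) =
    - (side L `^ gamma * (N (window b L) - N (window a L) -
       rho E * ((b - a) / side L `^ gamma))).
  by field; rewrite gt_eqF.
rewrite normrN normrM (gtr0_norm gL) -ler_pdivlMl // (le_trans H) //.
by rewrite le_eqVlt; apply/orP; left; apply/eqP; field; rewrite !gt_eqF.
Unshelve. all: end_near. Qed.

End EigenvalueProcess.

Theorem theorem1p6 (R : realType) (d : nat) (hd : (2 <= d)%N)
    (lambda : R) (hlambda : 0 < lambda)
    (mu2 : probability (measurableTypeR R) R)
    (disp : measure_display) (Omega : measurableType disp)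
    (P : probability Omega R) (V : 'rV[int]_d -> {RV P >-> R})
    (hV : iid_with_law V (convolution (cauchy_prob lambda) mu2))
    (rho : R -> R) (hrho : dos_function V rho)
    (gamma : R) (hgamma : 0 < gamma < (d%:R - 1) / (2 * d%:R))
    (beta : R) (hbeta : beta = d%:R - gamma)
    (E : R) (hE : 0 < rho E) :
  {ae P, forall w : Omega,
    vague_cvg (fun L : nat => eigenvalue_process V gamma beta E L w)
      (mscale (NngNum (ltW hE)) lebesgue_measure)}.
Proof.
have [crho [nu [N hN nuN] nurho]] := hrho.
have [g0 gd] := andP hgamma.
have side0 L : 0 < (2 * L + 1)%:R :> R by rewrite ltr0n addn1.
pose fluct (x : R) (L : nat) (w : Omega) : R := (2 * L + 1)%:R `^ (gamma - d%:R) *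
  (random_box_count V L (window gamma E x L) w - box_mean V L (window gamma E x L)).
(* Countably many window ends share one null set; codes of no rational are read as 0. *)
have flucts : {ae P, forall w, forall n : nat,
    fluct (ratr (odflt 0 (choice.unpickle n : option rat))) L w @[L --> \oo] --> (0 : R)}.
  apply: ae_foralln => n.
  exact: (fluctuation_ae_cvg0 hV (window gamma E _) hd hgamma).
apply: filterS flucts => w fluct0.
have {}fluct0 (q : rat) : fluct (ratr q) L w @[L --> \oo] --> (0 : R).
  by have := fluct0 (choice.pickle q); rewrite choice.pickleK.
have lebE (a b : R) : a < b -> mscale (NngNum (ltW hE)) lebesgue_measure `]a, b]%classic =
    (rho E * (b - a))%:E.
  by move=> ab; rewrite /mscale /= lebesgue_measure_itv /= lte_fin ab.
apply: vague_cvg_rational_intervals => p q pq; have pqR : ratr p < ratr q :> R by rewrite ltr_rat.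
  by rewrite [X in (X < _)%E](lebE _ _ pqR) ltry.
rewrite [X in _ --> X](lebE _ _ pqR).
under eq_fun do rewrite (eigenvalue_process_itv V gamma E beta _ w (ltW pqR)).
apply: cvg_EFin; first exact: nearW.
set a : R := ratr p in pqR *; set b : R := ratr q in pqR *.
pose bias (x : R) (L : nat) : R := (2 * L + 1)%:R `^ (gamma - d%:R) *
  (box_mean V L (window gamma E x L) - ((2 * L + 1) ^ d)%:R * N (window gamma E x L)).
have bias0 (x : R) : bias x L @[L --> \oo] --> (0 : R).
  (* The boundary term [(2L+1)^(d-1)] times [(2L+1)^(gamma-d)] has exponent [-(1 - gamma)]. *)
  have bound0 : (d * 2)%:R * (2 * L + 1)%:R `^ (- (1 - gamma)) @[L --> \oo] --> (0 : R).
    rewrite -[X in _ --> X](mulr0 (d * 2)%:R).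
    apply: cvgM; [exact: cvg_cst|apply: powR_box_side_cvg0].
    have d1 : 1 <= d%:R :> R by rewrite ler1n; lia.
    by move: gd; rewrite ltr_pdivlMr; nra.
  apply/cvgr0Pnorm_lt => e e0; move/cvgr0Pnorm_lt : bound0 => /(_ e e0).
  apply: filterS => L; apply: le_lt_trans.
  rewrite [leRHS]ger0_norm ?mulr_ge0 ?powR_ge0 // /bias normrM (ger0_norm (powR_ge0 _ _)).
  rewrite (le_trans (ler_wpM2l _ (box_mean_ids hV L _ hN))) ?powR_ge0 //.
  rewrite mulnA natrM natrX mulrCA ler_wpM2l //.
  rewrite -(powR_mulrn d.-1 (ltW (side0 L))) -powRD; last by rewrite (gt_eqF (side0 L)) implybT.
  suff -> : d.-1%:R = d%:R - 1 :> R.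
    by rewrite (_ : gamma - d%:R + (d%:R - 1) = - (1 - gamma)) //; ring.
  by rewrite -{2}(ltn_predK hd) -natr1 addrK.
(* Replacing counts by means costs [fluct], replacing means by [N] costs [bias]; the factor
   [(2L+1)^gamma] is [(2L+1)^(-beta)] times the volume. *)
suff : fluct b L w - fluct a L w + (bias b L - bias a L) +
    (2 * L + 1)%:R `^ gamma * (N (window gamma E b L) - N (window gamma E a L))
    @[L --> \oo] --> rho E * (b - a).
  apply: cvg_trans; apply: near_eq_cvg; apply: nearW => L.
  rewrite /fluct /bias hbeta opprB.
  have -> : (2 * L + 1)%:R `^ gamma =
      (2 * L + 1)%:R `^ (gamma - d%:R) * ((2 * L + 1) ^ d)%:R :> R.
    rewrite natrX -(powR_mulrn d (ltW (side0 L))) -powRD ?subrK //.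
    by rewrite (gt_eqF (side0 L)) implybT.
  by rewrite /=; ring.
rewrite (_ : rho E * (b - a) = (0 - 0) + (0 - 0) + rho E * (b - a)); last first.
  by rewrite subrr !add0r.
apply: cvgD; last exact: (window_ids_cvg crho nuN nurho hE g0 pqR).
by apply: cvgD; apply: cvgB; [exact: fluct0|exact: fluct0|exact: bias0|exact: bias0].
Qed.
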